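(* Let $n\ge 1$, let $C_0\ge 1$ be a real number, and let $X_1,\dots,X_n$ be 1-dependent, not necessarily identically distributed random variables taking values in the nonnegative integers with $X_i\le C_0$ for $1\le i\le n$. Let $S_n=X_1+\cdots+X_n$ and $F_n\{k\}=P(S_n=k)$. Let $s\ge 1$ be an integer, $h\ge 0$, and $\lambda_j\ge 0$ for $1\le j\le s$. Put $\nu_j(k)=\mathrm{E}\,X_k(X_k-1)\cdots(X_k-j+1)$, $\nu_1^{(n)}=\max_{1\le j\le n}\nu_1(j)$, $\Gamma_1=\sum_{k=1}^n\nu_1(k)$, $$a=e^{hC_0}(2+h)\sqrt{C_0},\qquad \psi=\exp\Bigl\{\max\Bigl(4a^2\Gamma_1,\ \sum_{m=1}^s\lambda_m(e^{hm}+1)\Bigr)\Bigr\},$$ $$K_1=\psi\sqrt{\pi+1}\,(e^h+1)^s(s+1+4a^2\Gamma_1),\qquad K_2=\psi\sqrt{\pi+1}\,(s+1+4a^2\Gamma_1)\frac{e^{hC_0}(e^h+1)^{s+1}}{(s+1)!},$$ $$K_3=16\psi a^4\sqrt{\pi+1}\,(5+6a^2\Gamma_1),\qquad K_4=4\psi a^3\sqrt{\pi+1}\,(1.1+a^2\Gamma_1).$$ If $a^2\nu_1^{(n)}\le 1/100$, then $$\sum_{k=0}^\infty e^{hk}\bigl|F_n\{k\}-\mathrm{CP}(s,\lambda)\{k\}\bigr|\le K_1\sum_{m=1}^s\Bigl|\frac{1}{m!}\sum_{j=1}^n\nu_m(j)-\sum_{l=m}^s\binom{l}{m}\lambda_l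\Bigr|+K_2\sum_{j=1}^n\nu_{s+1}(j)+K_3\sum_{j=1}^n\nu_1^2(j)+K_4\sum_{j=2}^n|\mathrm{Cov}(X_{j-1},X_j)|.$$
   Context: Random variables $X_1,\dots,X_n$ are 1-dependent if for all $1\le p<q\le n$ with $q-p>1$ the sigma-algebras generated by $X_1,\dots,X_p$ and by $X_q,\dots,X_n$ are independent. $\mathrm{CP}(s,\lambda)=\mathrm{CP}(s,\lambda_1,\dots,\lambda_s)$ is the compound Poisson distribution of $N_1+2N_2+\cdots+sN_s$, where $N_1,\dots,N_s$ are independent Poisson random variables with means $\lambda_1,\dots,\lambda_s$; $\mathrm{CP}(s,\lambda)\{k\}$ is the mass it assigns to $k$. $\nu_1^2(j)$ means $(\nu_1(j))^2$. *)

(* Defs.v *)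
From HB Require Import structures.
From mathcomp Require Import all_boot all_order all_algebra.
From mathcomp Require Import all_classical all_reals all_analysis.

Set Implicit Arguments.
Unset Strict Implicit.
Unset Printing Implicit Defensive.

Import Order.TTheory GRing.Theory Num.Theory.

Local Open Scope classical_set_scope.
Local Open Scope ring_scope.

Definition independent_systems (d : measure_display) (T : measurableType d)
    (R : realType) (P : probability T R) (F G : set (set T)) : Prop :=
  forall A B, F A -> G B -> P (A `&` B) = (P A * P B)%E.

Definition sigma_range (d : measure_display) (T : measurableType d)
    (X : nat -> T -> nat) (p q : nat) : set (set T) :=
  <<s \bigcup_(i in [set i | (p <= i <= q)%N])
        g_sigma_algebra_preimage (X i) >>.

Definition one_dependent (d : measure_display) (T : measurableType d)
    (R : realType) (P : probability T R) (n : nat)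
    (X : nat -> {RV P >-> nat}) : Prop :=
  forall p q : nat, (1 <= p)%N -> (p < q)%N -> (q <= n)%N -> (1 < q - p)%N ->
    independent_systems P (sigma_range X 1 p) (sigma_range X q n).

(* Since [n ^_ j = n (n - 1) ... (n - j + 1)] in nat (and 0 when j > n), this
   is E X(X - 1)...(X - j + 1). *)
Definition factorial_moment (d : measure_display) (T : measurableType d)
    (R : realType) (P : probability T R) (X : {RV P >-> nat}) (j : nat) : R :=
  fine 'E_P[fun w => ((X w) ^_ j)%:R].

Definition add_mul (m : nat) (xy : nat * nat) : nat := (xy.1 + m * xy.2)%N.

Lemma measurable_add_mul (m : nat) : measurable_fun [set: nat * nat] (add_mul m).
Proof.
move=> _ Y _; rewrite setTI.
rewrite (_ : _ @^-1` _ =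
    \bigcup_(x in [set: nat]) \bigcup_(y in [set y | Y (x + m * y)%N])
      ([set x] `*` [set y])).
  apply: bigcup_measurable => x _; apply: bigcup_measurable => y _.
  exact: measurableX.
apply/seteqP; split => [[x y] /= Yxy|[x y] /= [x' _ [y' /= Yxy [-> ->]]]] //.
by exists x => //; exists y.
Qed.

HB.instance Definition _ (m : nat) :=
  isMeasurableFun.Build _ _ _ _ (add_mul m) (measurable_add_mul m).

(* The law of N_1 + 2 N_2 + ... + s N_s: independence of N_{s+1} from the
   previous ones is expressed by the product measure.  The nat argument of
   [poisson_prob] is a dummy, and [poisson_prob 0 _] is the Dirac mass at 0.
   The values of [lambda] outside 1..s are irrelevant. *)
Fixpoint compound_poisson (R : realType) (s : nat) (lambda : nat -> R)
    : probability nat R :=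
  if s is s'.+1 then
    distribution (compound_poisson s' lambda \x poisson_prob (lambda s) 0)%E
      (add_mul s)
  else \d_0%N.

(* Main.v *)
(* Identify a law on the naturals with its generating series and measure it
   by the weighted l1-norm, the sum of w^k |p_k| with w = e^h.  This norm is
   submultiplicative, so it can replace the Fourier inversion of the
   characteristic function method; truncating it at degree N makes every object
   a polynomial, and N tends to infinity only at the very end.

   Let f_k be the series of S_k, let g_k = E z^{X_k} - 1 and W = e^{h C0}.
   By 1-dependence E z^{S_{k-2}} (z^{X_k} - 1) = f_{k-2} g_k, hence
     f_k - f_{k-1} (1 + g_k)
       = E z^{S_{k-2}} (z^{X_{k-1}} - 1) (z^{X_k} - 1)
         - E z^{S_{k-2}} (z^{X_{k-1}} - 1) g_k.
   Bounding z^{S_{k-2}} by W z^{S_{k-3}} in norm restores independence, so the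
   right side is O(E X_{k-1} X_k + E X_{k-1} E X_k), while 1 + g_k differs from
   (1 + g_k / m)^m by O((E X_k)^2).  On the other side CP(s, lambda) is the m-th
   power of CP(s, lambda / m).  It remains to compare two m-th powers whose
   bases agree with 1 + G / m and 1 + Q / m up to O(m^-2), where G is the sum of
   the g_k and Q that of the lambda_j (z^j - 1); as m tends to infinity this
   costs e^L |G - Q|, and G - Q is expanded in powers of z - 1. *)
Require Import Defs.
From HB Require Import structures.
From mathcomp Require Import all_boot all_order all_algebra.
From mathcomp Require Import all_classical all_reals all_analysis.
From mathcomp Require Import ring lra.

Set Implicit Arguments.
Unset Strict Implicit.
Unset Printing Implicit Defensive.

Import Order.TTheory GRing.Theory Num.Theory.

Local Open Scope classical_set_scope.
Local Open Scope ring_scope.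

(** * The truncated weighted norm *)

Section TruncatedNorm.
Variables (R : realType) (N : nat) (w : R).
Hypothesis w_ge0 : 0 <= w.
Implicit Types p q : {poly R}.

(** Only a seminorm: for w > 0 it vanishes exactly on the multiples of ['X^N], so
    [wnorm (p - q) = 0] expresses congruence modulo ['X^N]. *)
Definition wnorm p : R := \sum_(k < N) w ^+ k * `|p`_k|.

Lemma wnorm_ge0 p : 0 <= wnorm p.
Proof. by apply: sumr_ge0 => k _; rewrite mulr_ge0 ?exprn_ge0. Qed.

Lemma wnorm0 : wnorm 0 = 0.
Proof. by apply: big1 => k _; rewrite coef0 normr0 mulr0. Qed.

Lemma wnormD p q : wnorm (p + q) <= wnorm p + wnorm q.
Proof.
rewrite -big_split ler_sum //= => k _.
by rewrite -mulrDr coefD ler_wpM2l ?exprn_ge0 // ler_normD.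
Qed.

Lemma wnormZ (c : R) p : wnorm (c *: p) = `|c| * wnorm p.
Proof.
by rewrite mulr_sumr; apply: eq_bigr => k _; rewrite coefZ normrM mulrCA.
Qed.

Lemma wnormN p : wnorm (- p) = wnorm p.
Proof. by rewrite -scaleN1r wnormZ normrN1 mul1r. Qed.

Lemma wnormB p q : wnorm (p - q) <= wnorm p + wnorm q.
Proof. by rewrite -[wnorm q]wnormN wnormD. Qed.

Lemma wnorm_sum (I : Type) (r : seq I) (P : pred I) (F : I -> {poly R}) :
  wnorm (\sum_(i <- r | P i) F i) <= \sum_(i <- r | P i) wnorm (F i).
Proof.
apply: (big_ind2 (fun p x => wnorm p <= x)); rewrite ?wnorm0 // => p x q y px qy.
by rewrite (le_trans (wnormD p q)) // lerD.
Qed.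

Lemma wnorm_Xn k : wnorm 'X^k <= w ^+ k.
Proof.
have [kN|Nk] := ltnP k N.
  rewrite /wnorm (bigD1 (Ordinal kN)) //= coefXn eqxx normr1 mulr1 big1 ?addr0 //.
  move=> i ik; rewrite coefXn -(inj_eq val_inj) /= in ik *.
  by rewrite (negbTE ik) normr0 mulr0.
rewrite /wnorm big1 ?exprn_ge0 // => i _.
by rewrite coefXn ltn_eqF ?normr0 ?mulr0 // (leq_trans (ltn_ord i)).
Qed.

Lemma wnorm_Xn_eq0 k : (N <= k)%N -> wnorm 'X^k = 0.
Proof.
move=> Nk; rewrite /wnorm big1 // => i _.
by rewrite coefXn ltn_eqF ?normr0 ?mulr0 // (leq_trans (ltn_ord i)).
Qed.

Lemma wnorm1 : wnorm 1 <= 1.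
Proof. by have := wnorm_Xn 0; rewrite !expr0. Qed.

(** Multiplication by ['X^k] shifts the coefficients; those pushed to degree [N] or more are lost,
    hence an inequality. *)
Lemma wnorm_XnM k p : wnorm ('X^k * p) <= w ^+ k * wnorm p.
Proof.
rewrite /wnorm mulr_sumr.
rewrite -!(big_mkord xpredT (fun i => w ^+ i * `|_`_i|)).
rewrite -(big_mkord xpredT (fun i => w ^+ k * (w ^+ i * `|p`_i|))).
have [kN|/ltnW Nk] := leqP k N; last first.
  rewrite big_nat big1 ?sumr_ge0 // => [i _|i /andP[_ iN]].
    by rewrite mulr_ge0 ?exprn_ge0 // mulr_ge0 ?exprn_ge0.
  by rewrite coefXnM (leq_trans iN Nk) normr0 mulr0.
rewrite (big_cat_nat _ kN) //= big_nat big1 ?add0r; last first.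
  by move=> i /andP[_ ik]; rewrite coefXnM ik normr0 mulr0.
rewrite -{1}[k]add0n big_addn [leRHS](big_cat_nat _ (leq_subr k N)) //=.
rewrite (eq_bigr (fun i => w ^+ k * (w ^+ i * `|p`_i|))) ?lerDl.
  by apply: sumr_ge0 => i _; rewrite mulr_ge0 ?exprn_ge0 // mulr_ge0 ?exprn_ge0.
by move=> i _; rewrite coefXnM ltnNge leq_addl /= addnK mulrA -exprD addnC.
Qed.

(* Only the coefficients of degree less than [N] are seen by the norm, hence
   the detour by a truncation of [p]. *)
Lemma wnormM p q : wnorm (p * q) <= wnorm p * wnorm q.
Proof.
pose t := \poly_(i < N) p`_i.
have -> : wnorm (p * q) = wnorm (t * q).
  apply: eq_bigr => k _; rewrite !coefM; congr (_ * `| _ |).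
  apply: eq_bigr => i _.
  by rewrite coef_poly (leq_ltn_trans _ (ltn_ord k)) // -ltnS.
rewrite {1}/t poly_def mulr_suml (le_trans (wnorm_sum _ _ _)) // mulr_suml.
apply: ler_sum => i _; rewrite -scalerAl wnormZ -mulrA [leRHS]mulrCA.
by rewrite ler_wpM2l // wnorm_XnM.
Qed.

Lemma wnormX p m : wnorm (p ^+ m) <= wnorm p ^+ m.
Proof.
elim: m => [|m IH]; first by rewrite !expr0 wnorm1.
by rewrite !exprS (le_trans (wnormM _ _)) // ler_wpM2l // wnorm_ge0.
Qed.

Lemma wnorm_prod (I : Type) (r : seq I) (P : pred I) (F : I -> {poly R}) :
  wnorm (\prod_(i <- r | P i) F i) <= \prod_(i <- r | P i) wnorm (F i).
Proof.
apply: (big_ind2 (fun p x => wnorm p <= x)); rewrite ?wnorm1 // => p x q y px qy.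
by rewrite (le_trans (wnormM p q)) // ler_pM ?wnorm_ge0.
Qed.

(** Factoring p - q out of p^m - q^m leaves m products of m - 1 factors each, of norm at most
    r^(m-1). *)
Lemma wnorm_subX p q r m : wnorm p <= r -> wnorm q <= r ->
  wnorm (p ^+ m - q ^+ m) <= m%:R * r ^+ m.-1 * wnorm (p - q).
Proof.
move=> pr qr; rewrite subrXX (le_trans (wnormM _ _)) // mulrC.
rewrite ler_wpM2r ?wnorm_ge0 // (le_trans (wnorm_sum _ _ _)) //.
rewrite -[X in X%:R]card_ord -sum1_card natr_sum mulr_suml ler_sum // => i _.
rewrite mul1r (le_trans (wnormM _ _)) //.
have im : (i <= m.-1)%N by case: m i => [[]//|m] i; rewrite -ltnS.
rewrite -{2}(subnK im) exprD ler_pM ?wnorm_ge0 //.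
  by rewrite (le_trans (wnormX _ _)) // lerXn2r ?nnegrE ?wnorm_ge0 // (le_trans (wnorm_ge0 p)).
by rewrite (le_trans (wnormX _ _)) // lerXn2r ?nnegrE ?wnorm_ge0 // (le_trans (wnorm_ge0 p)).
Qed.

Lemma wnorm_Xsub1_exp m : wnorm (('X - 1) ^+ m) <= (w + 1) ^+ m.
Proof.
rewrite (le_trans (wnormX _ _)) // lerXn2r ?nnegrE ?wnorm_ge0 ?addr_ge0 //.
by rewrite (le_trans (wnormB _ _)) // lerD ?wnorm1 // -['X]expr1 (le_trans (wnorm_Xn 1)).
Qed.

(* The Taylor remainder of [x |-> 'X^x] at ['X = 1] satisfies Pascal's rule
   R_{r+1}(x+1) = R_{r+1}(x) + ('X - 1) R_r(x). *)
Lemma wnorm_Xn_taylor r x : 1 <= w ->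
  wnorm ('X^x - \sum_(m < r) 'C(x, m)%:R *: ('X - 1) ^+ m)
  <= 'C(x, r)%:R * w ^+ x * (w + 1) ^+ r.
Proof.
move=> w1; elim: x r => [|x IH] [|r].
- by rewrite big_ord0 subr0 expr0 bin0 !mulr1 wnorm1.
- rewrite big_ord_recl big1 => [|i _]; last by rewrite scale0r.
  by rewrite bin0 scale1r !expr0 addr0 subrr wnorm0 mul0r mul0r.
- by rewrite big_ord0 subr0 bin0 mul1r mulr1 wnorm_Xn.
pose Y : {poly R} := 'X - 1; rewrite -/Y.
have -> : 'X^(x.+1) - \sum_(m < r.+1) 'C(x.+1, m)%:R *: Y ^+ m =
  ('X^x - \sum_(m < r.+1) 'C(x, m)%:R *: Y ^+ m) +
  Y * ('X^x - \sum_(m < r) 'C(x, m)%:R *: Y ^+ m).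
  rewrite !big_ord_recl !bin0 !scale1r !expr0 mulrBr mulr_sumr.
  have -> : \sum_(i < r) 'C(x.+1, bump 0 i)%:R *: Y ^+ bump 0 i =
     \sum_(i < r) 'C(x, bump 0 i)%:R *: Y ^+ bump 0 i +
     \sum_(i < r) Y * ('C(x, i)%:R *: Y ^+ i).
    rewrite -big_split; apply: eq_bigr => i _ /=.
    by rewrite binS natrD scalerDl exprS -scalerAr.
  rewrite exprS /Y /=; ring.
rewrite (le_trans (wnormD _ _)) //.
apply: (@le_trans _ _ ('C(x, r.+1)%:R * w ^+ x * (w + 1) ^+ r.+1 +
    (w + 1) * ('C(x, r)%:R * w ^+ x * (w + 1) ^+ r))).
  rewrite lerD ?IH // (le_trans (wnormM _ _)) // ler_pM ?wnorm_ge0 ?IH //.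
  by have := wnorm_Xsub1_exp 1; rewrite !expr1.
(* Pascal's rule merges both terms; the factor w missing from w^(x+1) is at least 1. *)
rewrite binS natrD.
rewrite [leLHS](_ : _ =
    ('C(x, r.+1)%:R + 'C(x, r)%:R) * w ^+ x * (w + 1) ^+ r.+1); last first.
  by rewrite exprS; ring.
rewrite ler_wpM2r ?exprn_ge0 ?addr_ge0 // ler_wpM2l ?addr_ge0 //.
by rewrite ler_weXn2l.
Qed.

End TruncatedNorm.

(** * First-order expansions at t = 0 *)

Lemma ler_sum_exp_coeff (R : realType) (x : R) (M : nat) : 0 <= x ->
  \sum_(k < M) x ^+ k / k`!%:R <= expR x.
Proof.
move=> x0; rewrite -(big_mkord xpredT (fun k => x ^+ k / k`!%:R)).
apply: (nondecreasing_cvgn_le _ (@is_cvg_series_exp_coeff R x)).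
by apply: nondecreasing_series => k _ _; exact: exp_coeff_ge0.
Qed.

Section FirstOrder.
Variables (R : realType) (N : nat) (w : R).
Hypothesis w_ge0 : 0 <= w.
Local Notation wnorm := (wnorm N w).

(** The constant may depend on [N] and need not be tracked: it enters later bounds only as C / m,
    which tends to 0. *)
Definition first_order (p : R -> {poly R}) (q : {poly R}) :=
  exists C : R, forall t : R, 0 <= t <= 1 -> wnorm (p t - 1 - t *: q) <= C * t ^+ 2.

Lemma first_order_affine q : first_order (fun t => 1 + t *: q) q.
Proof.
exists 0 => t _; rewrite (_ : 1 + t *: q - 1 - t *: q = 0) ?wnorm0 ?mul0r //.
by rewrite [1 + _]addrC addrK subrr.
Qed.

Lemma first_orderM p1 q1 p2 q2 : first_order p1 q1 -> first_order p2 q2 ->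
  first_order (fun t => p1 t * p2 t) (q1 + q2).
Proof.
move=> [C1 H1] [C2 H2].
have C1_ge0 : 0 <= C1.
  have := H1 1; rewrite ler01 lexx expr1n mulr1 => /(_ isT).
  exact: le_trans (wnorm_ge0 _ w_ge0 _).
have C2_ge0 : 0 <= C2.
  have := H2 1; rewrite ler01 lexx expr1n mulr1 => /(_ isT).
  exact: le_trans (wnorm_ge0 _ w_ge0 _).
(* The three summands bound the terms of r1 p2 + (1 + t q1) r2 + t^2 q1 q2, the remainder of the
   product. *)
exists (C1 * (1 + wnorm q2 + C2) + (1 + wnorm q1) * C2 + wnorm q1 * wnorm q2).
move=> t /[dup] t01 /andP[t0 t1].
have {}H1 := H1 t t01; have {}H2 := H2 t t01.
set r1 := p1 t - 1 - t *: q1 in H1; set r2 := p2 t - 1 - t *: q2 in H2.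
have n1 q : wnorm (1 + t *: q) <= 1 + wnorm q.
  rewrite (le_trans (wnormD _ w_ge0 _ _)) // lerD ?wnorm1 // wnormZ ger0_norm //.
  by rewrite ler_piMl // wnorm_ge0.
have t21 : t ^+ 2 <= 1 by rewrite expr_le1.
have n2 : wnorm (p2 t) <= 1 + wnorm q2 + C2.
  rewrite (_ : p2 t = (1 + t *: q2) + r2); last by rewrite /r2; ring.
  rewrite (le_trans (wnormD _ w_ge0 _ _)) // lerD // (le_trans H2) //.
  by rewrite ler_piMr.
have -> : p1 t * p2 t - 1 - t *: (q1 + q2) =
    r1 * p2 t + (1 + t *: q1) * r2 + (t ^+ 2) *: (q1 * q2).
  by rewrite /r1 /r2 -!mul_polyC polyC_exp; ring.
rewrite (le_trans (wnormD _ w_ge0 _ _)) // [leRHS]mulrDl lerD //; last first.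
  rewrite wnormZ ger0_norm ?exprn_ge0 // mulrC ler_wpM2r ?exprn_ge0 //.
  exact: wnormM.
rewrite (le_trans (wnormD _ w_ge0 _ _)) // [leRHS]mulrDl lerD //; last first.
  by rewrite (le_trans (wnormM _ w_ge0 _ _)) // -mulrA ler_pM // wnorm_ge0.
by rewrite (le_trans (wnormM _ w_ge0 _ _)) // mulrAC ler_pM // wnorm_ge0.
Qed.

Lemma first_order_prod (I : Type) (s : seq I) (P : pred I)
    (p : I -> R -> {poly R}) (q : I -> {poly R}) :
  (forall i, P i -> first_order (p i) (q i)) ->
  first_order (fun t => \prod_(i <- s | P i) p i t) (\sum_(i <- s | P i) q i).
Proof.
move=> H; elim: s => [|i s IH].
  by exists 0 => t _; rewrite !big_nil scaler0 subr0 subrr wnorm0 mul0r.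
rewrite big_cons; have [Pi|nPi] := boolP (P i).
  have [C HC] := first_orderM (H i Pi) IH.
  by exists C => t; rewrite big_cons Pi; exact: HC.
have [C HC] := IH.
by exists C => t; rewrite big_cons (negbTE nPi); exact: HC.
Qed.

(** At t = 1/m both bases have norm at most e^(L/m), so [wnorm_subX] gives at most m e^L times the
    difference of the bases, which is (q1 - q2) / m up to (C1 + C2) / m^2. *)
Lemma wnorm_first_order_pow (L : R) p1 q1 p2 q2 :
  first_order p1 q1 -> first_order p2 q2 ->
  (forall t : R, 0 <= t <= 1 -> wnorm (p1 t) <= expR (t * L)) ->
  (forall t : R, 0 <= t <= 1 -> wnorm (p2 t) <= expR (t * L)) ->
  0 <= L ->
  exists C : R, forall m, (0 < m)%N ->
    wnorm (p1 m%:R^-1 ^+ m - p2 m%:R^-1 ^+ m)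
    <= expR L * wnorm (q1 - q2) + C / m%:R.
Proof.
move=> [C1 H1] [C2 H2] n1 n2 L0; exists (expR L * (C1 + C2)) => m m0.
set t := m%:R^-1.
have m_gt0 : 0 < m%:R :> R by rewrite ltr0n.
have t01 : 0 <= t <= 1.
  by rewrite invr_ge0 ltW //= invf_le1 // ler1n.
have /andP[t0 t1] := t01.
rewrite (le_trans (wnorm_subX w_ge0 m (n1 t t01) (n2 t t01))) //.
rewrite -expRM_natl.
have eL : expR (m.-1%:R * (t * L)) <= expR L.
  rewrite ler_expR mulrA ler_piMl // /t ler_pdivrMr // mul1r ler_nat.
  exact: leq_pred.
have d12 : wnorm (p1 t - p2 t) <= t * wnorm (q1 - q2) + (C1 + C2) * t ^+ 2.
  have -> : p1 t - p2 t = t *: (q1 - q2) +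
      ((p1 t - 1 - t *: q1) - (p2 t - 1 - t *: q2)).
    by rewrite -!mul_polyC; ring.
  rewrite (le_trans (wnormD _ w_ge0 _ _)) // wnormZ ger0_norm // lerD //.
  by rewrite (le_trans (wnormB _ w_ge0 _ _)) // mulrDl lerD ?H1 ?H2.
apply: (@le_trans _ _ (m%:R * expR L * (t * wnorm (q1 - q2) + (C1 + C2) * t ^+ 2))).
  by rewrite ler_pM ?wnorm_ge0 ?mulr_ge0 ?expR_ge0 // ler_wpM2l.
rewrite le_eqVlt; apply/orP; left; apply/eqP.
by rewrite /t; field; rewrite gt_eqF.
Qed.

End FirstOrder.

(** * Compound Poisson laws *)

Section PoissonPolynomial.
Variables (R : realType) (N : nat) (w : R).
Hypothesis w_ge0 : 0 <= w.
Local Notation wnorm := (wnorm N w).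

Definition poisson_coef (t : R) (k : nat) : R := t ^+ k / k`!%:R * expR (- t).

Lemma poisson_coef_ge0 t k : 0 <= t -> 0 <= poisson_coef t k.
Proof.
by move=> t0; rewrite mulr_ge0 ?expR_ge0 // mulr_ge0 ?exprn_ge0 ?invr_ge0.
Qed.

Lemma poisson_coef_le t k : 0 <= t -> poisson_coef t k <= t ^+ k.
Proof.
move=> t0; rewrite /poisson_coef -mulrA ler_piMr ?exprn_ge0 //.
rewrite mulr_ile1 ?invr_ge0 ?expR_ge0 ?expR_le1 ?oppr_le0 //.
by rewrite invf_le1 ?ltr0n ?ler1n fact_gt0.
Qed.

Lemma poisson_coefD (t u : R) k :
  poisson_coef (t + u) k =
  \sum_(i < k.+1) poisson_coef t i * poisson_coef u (k - i).
Proof.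
rewrite /poisson_coef opprD expRD [t + u]addrC exprDn 2!mulr_suml; apply: eq_bigr => i _.
have ik : (i <= k)%N by rewrite -ltnS.
rewrite -mulr_natr -(bin_fact ik) !natrM.
have := bin_gt0 k i; rewrite ik => b0.
by field; rewrite !pnatr_eq0 -!lt0n !fact_gt0 b0.
Qed.

(* [N.+2] terms, so that the linear term is present for every [N]. *)
Definition poisson_poly (j : nat) (t : R) : {poly R} :=
  (\poly_(k < N.+2) poisson_coef t k) \Po 'X^j.

Lemma poisson_polyE j t :
  poisson_poly j t = \sum_(k < N.+2) poisson_coef t k *: 'X^(j * k).
Proof.
rewrite /poisson_poly poly_def raddf_sum; apply: eq_bigr => k _ /=.
by rewrite linearZ /= comp_Xn_poly exprM.
Qed.

(** Bounding e^(-t) by 1 already gives exp(t w^j); the added 1 is slack that matches the exponent of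
    psi. *)
Lemma wnorm_poisson_poly j t : 0 <= t ->
  wnorm (poisson_poly j t) <= expR (t * (w ^+ j + 1)).
Proof.
move=> t0; rewrite poisson_polyE (le_trans (wnorm_sum _ w_ge0 _ _ _)) //.
apply: (@le_trans _ _ (\sum_(k < N.+2) (t * w ^+ j) ^+ k / k`!%:R)).
  apply: ler_sum => k _; rewrite wnormZ ger0_norm ?poisson_coef_ge0 //.
  rewrite exprMn -exprM [leRHS]mulrAC ler_pM ?wnorm_ge0 ?wnorm_Xn ?poisson_coef_ge0 //.
  by rewrite /poisson_coef ler_piMr ?mulr_ge0 ?exprn_ge0 // expR_le1 oppr_le0.
rewrite (le_trans (ler_sum_exp_coeff _ _)) ?mulr_ge0 ?exprn_ge0 // ler_expR.
by rewrite mulrDr lerDl mulr1.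
Qed.

Lemma poisson_poly0 j : poisson_poly j 0 = 1.
Proof.
rewrite poisson_polyE big_ord_recl big1 => [|i _].
  by rewrite /poisson_coef oppr0 expR0 muln0 fact0 divr1 mulr1 addr0 scale1r.
by rewrite /poisson_coef expr0n mul0r mul0r scale0r.
Qed.

(** Before substituting ['X^j], the two sides agree below degree N + 2 by additivity of Poisson
    laws. Since j > 0, the substitution keeps the other terms in degrees invisible to the norm. *)
Lemma wnorm_poisson_polyD j t u : (0 < j)%N ->
  wnorm (poisson_poly j t * poisson_poly j u - poisson_poly j (t + u)) = 0.
Proof.
move=> j0; rewrite /poisson_poly -comp_polyM -raddfB /=.
set D := _ * _ - _.
have D0 k : (k < N.+2)%N -> D`_k = 0.
  move=> kN; rewrite coefB coefM coef_poly kN poisson_coefD.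
  apply/eqP; rewrite subr_eq0; apply/eqP; apply: eq_bigr => i _.
  by rewrite !coef_poly !(leq_ltn_trans _ kN) ?leq_subr // -ltnS.
apply/eqP; rewrite eq_le wnorm_ge0 // andbT comp_polyE.
rewrite (le_trans (wnorm_sum _ w_ge0 _ _ _)) // big1 // => i _.
rewrite wnormZ -exprM.
have [iN|Ni] := ltnP i N.+2; first by rewrite D0 ?normr0 ?mul0r.
rewrite wnorm_Xn_eq0 ?mulr0 // (leq_trans _ (leq_pmull i j0)) //.
exact: leq_trans (leqW (leqnSn N)) Ni.
Qed.

Lemma first_order_poisson_poly j (l : R) : 0 <= l ->
  first_order N w (fun t => poisson_poly j (t * l)) (l *: ('X^j - 1)).
Proof.
move=> l0.
(* The summands bound, in order, the error in the constant term, the error in the linear term, and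
   all terms with k >= 2. *)
exists (l ^+ 2 + l ^+ 2 * w ^+ j + \sum_(k < N) l ^+ k.+2 * w ^+ (j * k.+2)).
move=> t /andP[t0 t1]; set u := t * l.
have u0 : 0 <= u by rewrite mulr_ge0.
have e0 : 0 <= 1 - expR (- u) <= u.
  rewrite subr_ge0 expR_le1 oppr_le0 u0 /=.
  by have := expR_ge1Dx (- u); lra.
(* From e^(-u) (1 + u) <= 1 one gets e^(-u) - 1 + u <= u (1 - e^(-u)) <= u^2. *)
have e1 : 0 <= expR (- u) - 1 + u <= u ^+ 2.
  have -> /= : 0 <= expR (- u) - 1 + u by have := expR_ge1Dx (- u); lra.
  have : expR (- u) * (1 + u) <= 1.
    rewrite -[leRHS]expR0 -(addNr u) expRD ler_wpM2l ?expR_ge0 //.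
    exact: expR_ge1Dx.
  by move: (expR (- u)) e0 => e /andP[]; nra.
rewrite poisson_polyE !big_ord_recl /= addrA.
set S := \sum_(i < N) _.
have -> : poisson_coef u 0 *: 'X^(j * 0) + poisson_coef u (bump 0 0) *: 'X^(j * bump 0 0)
    + S - 1 - t *: (l *: ('X^j - 1)) =
  (expR (- u) - 1 + u) *: 1 + ((expR (- u) - 1) * u) *: 'X^j + S :> {poly R}.
  rewrite /poisson_coef muln0 muln1 !expr0 fact0 factS fact0 muln1 expr1 !divr1 mul1r.
  rewrite scalerA /u -!mul_polyC !rmorphM !rmorphD /= !rmorphN /= polyC1 !rmorphM /=.
  by ring.
rewrite (le_trans (wnormD _ w_ge0 _ _)) // [leRHS]mulrDl lerD //.
  rewrite (le_trans (wnormD _ w_ge0 _ _)) // [leRHS]mulrDl lerD // wnormZ.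
    have /andP[e10 e12] := e1.
    rewrite ger0_norm // (le_trans (ler_wpM2l e10 (wnorm1 _ w_ge0))) // mulr1.
    by rewrite (le_trans e12) // /u exprMn mulrC.
  have /andP[e00 e02] := e0.
  rewrite normrM distrC (ger0_norm e00) (ger0_norm u0) [leRHS]mulrAC.
  rewrite ler_pM ?mulr_ge0 ?wnorm_ge0 ?wnorm_Xn //.
  by rewrite (le_trans (ler_wpM2r u0 e02)) // /u -expr2 exprMn mulrC.
rewrite (le_trans (wnorm_sum _ w_ge0 _ _ _)) // mulr_suml ler_sum // => i _.
rewrite wnormZ [leRHS]mulrAC ler_pM ?wnorm_ge0 ?wnorm_Xn //.
rewrite ger0_norm ?poisson_coef_ge0 // (le_trans (poisson_coef_le _ u0)) //.
by rewrite /u exprMn mulrC ler_wpM2l ?exprn_ge0 // ler_wiXn2l.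
Qed.

(** Modulo ['X^N], the generating series of CP(s, t lambda). *)
Definition cp_poly (s : nat) (lambda : nat -> R) (t : R) : {poly R} :=
  \prod_(1 <= j < s.+1) poisson_poly j (t * lambda j).

Section CP.
Variables (s : nat) (lambda : nat -> R).
Hypothesis lambda_ge0 : forall j, (1 <= j <= s)%N -> 0 <= lambda j.

Lemma wnorm_cp_poly t : 0 <= t ->
  wnorm (cp_poly s lambda t)
  <= expR (t * \sum_(1 <= j < s.+1) lambda j * (w ^+ j + 1)).
Proof.
move=> t0; rewrite mulr_sumr expR_sum.
rewrite (le_trans (wnorm_prod _ w_ge0 _ _ _)) // /cp_poly !big_nat.
apply: ler_prod => j js; rewrite wnorm_ge0 //= mulrA wnorm_poisson_poly //.
by rewrite mulr_ge0 // lambda_ge0.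
Qed.

(** Infinite divisibility modulo ['X^N]: this congruence is transitive and compatible with products,
    so the rates of each Poisson factor can be added one at a time. *)
Lemma wnorm_cp_polyX m : (0 < m)%N ->
  wnorm (cp_poly s lambda m%:R^-1 ^+ m - cp_poly s lambda 1) = 0.
Proof.
have eqM (p q p' q' : {poly R}) : wnorm (p - q) = 0 -> wnorm (p' - q') = 0 ->
    wnorm (p * p' - q * q') = 0.
  move=> pq pq'; apply/eqP; rewrite eq_le wnorm_ge0 // andbT.
  have -> : p * p' - q * q' = (p - q) * p' + q * (p' - q') by ring.
  rewrite (le_trans (wnormD _ w_ge0 _ _)) // -[leRHS]addr0.
  by rewrite lerD // (le_trans (wnormM _ w_ge0 _ _)) ?pq ?pq' ?mul0r ?mulr0.
have eqT (p q r : {poly R}) : wnorm (p - q) = 0 -> wnorm (q - r) = 0 ->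
    wnorm (p - r) = 0.
  move=> pq qr; apply/eqP; rewrite eq_le wnorm_ge0 // andbT.
  have -> : p - r = (p - q) + (q - r) by rewrite addrA subrK.
  by rewrite (le_trans (wnormD _ w_ge0 _ _)) // pq qr addr0.
move=> m0; rewrite /cp_poly -prodrXl !big_nat.
apply: (big_ind2 (fun p q => wnorm (p - q) = 0)) => [||j /andP[j0 _]].
- by rewrite subrr wnorm0.
- by move=> p p' q q'; exact: eqM.
set u := m%:R^-1 * lambda j.
have -> : 1 * lambda j = m%:R * u by rewrite mul1r mulVKf // pnatr_eq0 -lt0n.
elim: (m) => [|k IH].
  by rewrite mul0r poisson_poly0 expr0 subrr wnorm0.
rewrite exprS -[k.+1]add1n natrD mulrDl mul1r.
apply: eqT (wnorm_poisson_polyD u (k%:R * u) j0).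
by apply: eqM => //; rewrite subrr wnorm0.
Qed.

End CP.
End PoissonPolynomial.

(** At rate 0 the law is the Dirac mass at 0, and the formula agrees with it because 0^0 = 1. *)
Lemma poisson_prob_set1 (R : realType) (l : R) (dummy k : nat) : 0 <= l ->
  poisson_prob l dummy [set k] = (poisson_coef l k)%:E.
Proof.
rewrite /poisson_prob /poisson_coef le_eqVlt => /predU1P[<-|l0].
  rewrite ltxx diracE oppr0 expR0 mulr1 expr0n.
  case: k => [|k]; first by rewrite mem_set // fact0 divr1.
  by rewrite memNset // mul0r.
by rewrite l0 esum_set1 ?lee_fin ?poisson_pmf_ge0 // /poisson_pmf l0.
Qed.

Lemma compound_poissonE (R : realType) (N s k : nat) (lambda : nat -> R) :
  (forall j, (1 <= j <= s)%N -> 0 <= lambda j) -> (k < N)%N ->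
  compound_poisson s lambda [set k] = ((cp_poly N s lambda 1)`_k)%:E.
Proof.
move=> + kN; elim: s k kN => [|s IH] k kN lambda_ge0.
  rewrite /= /cp_poly big_geq // coef1 diracE.
  by case: k {kN} => [|k]; [rewrite mem_set | rewrite memNset].
rewrite /cp_poly big_nat_recr //= -/(cp_poly N s lambda 1) mul1r.
pose A (y : nat) := [set x | (x + s.+1 * y)%N = k] `*` [set y].
have lam_ge0 : 0 <= lambda s.+1 by rewrite lambda_ge0 ?leqnn.
rewrite /distribution /pushforward.
(* Slicing by the value y of the last Poisson variable: (s+1) y <= k < N, so the slices cover the
   preimage, and they match the N + 2 terms of [poisson_poly]. *)
have -> : add_mul s.+1 @^-1` [set k] = \big[setU/set0]_(y < N.+2) A y.
  rewrite -bigcup_mkord; apply/seteqP; split => [[x y] /= xy|[x y]].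
    have yk : (y <= k)%N.
      by rewrite -xy /add_mul /= (leq_trans (leq_pmull y (ltn0Sn s))) // leq_addl.
    by exists y => //=; rewrite (leq_ltn_trans yk) // ltnW // ltnW // !ltnS.
  by move=> [y' _] [/= xk ->].
rewrite measure_bigsetU; last 2 first.
- by move=> y; apply: measurableX.
- by move=> y y' _ _ [[x z] [[_ <-] [_ <-]]].
rewrite poisson_polyE mulr_sumr coef_sum -sumEFin; apply: eq_bigr => y _.
rewrite /A; apply: (etrans (product_measure1E _ _ _ _)) => //.
rewrite [X in (_ * X)%E](poisson_prob_set1 0 y lam_ge0).
rewrite -scalerAr coefZ coefMXn.
have [ky|ky] := ltnP k (s.+1 * y)%N.
  rewrite (_ : [set x | _] = set0) ?measure0 ?mul0e ?mulr0 //.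
  by apply/seteqP; split => // x /= xk; rewrite -xk ltnNge leq_addl in ky.
rewrite (_ : [set x | _] = [set (k - s.+1 * y)%N]); last first.
  apply/seteqP; split => [x /= <-|x /= ->]; first by rewrite addnK.
  by rewrite subnK.
rewrite [X in (X * _)%E](IH _ (leq_ltn_trans (leq_subr _ _) kN)).
  by rewrite -EFinM mulrC.
by move=> j /andP[j1 js]; rewrite lambda_ge0 // j1 leqW.
Qed.

(** * Sums of 1-dependent variables on a finite space *)

(** By induction, since passing from m to m + 1 multiplies the remainder by 1 + q and adds m q^2;
    the constant closes because m^2 + m <= (m + 1)^2. For q = g / m the bound does not depend on
    m. *)
Lemma wnorm_binomial_taylor (R : realType) (N : nat) (w : R) (q : {poly R}) m :
  0 <= w ->
  wnorm N w ((1 + q) ^+ m - 1 - m%:R *: q)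
  <= (m%:R * wnorm N w q) ^+ 2 * expR (m%:R * wnorm N w q).
Proof.
move=> w0; set x := wnorm N w q.
have x0 : 0 <= x by exact: wnorm_ge0.
elim: m => [|m IH].
  by rewrite expr0 subrr sub0r scale0r oppr0 wnorm0 mul0r expr0n mul0r.
have -> : (1 + q) ^+ m.+1 - 1 - m.+1%:R *: q =
    (1 + q) * ((1 + q) ^+ m - 1 - m%:R *: q) + m%:R *: q ^+ 2.
  by rewrite exprS -[m.+1]addn1 natrD -!mul_polyC rmorphD /= polyC1; ring.
rewrite (le_trans (wnormD _ w0 _ _)) //.
have n1 : wnorm N w (1 + q) <= expR x.
  rewrite (le_trans (wnormD _ w0 _ _)) // (le_trans _ (expR_ge1Dx x)) //.
  by rewrite lerD2r wnorm1.
have n2 : wnorm N w (m%:R *: q ^+ 2) <= m%:R * x ^+ 2 * expR (m.+1%:R * x).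
  rewrite wnormZ ger0_norm // -mulrA ler_wpM2l //.
  rewrite (le_trans (wnormX _ w0 _ _)) // ler_peMr ?exprn_ge0 //.
  by rewrite -[leLHS]expR0 ler_expR mulr_ge0.
apply: (@le_trans _ _ (expR x * ((m%:R * x) ^+ 2 * expR (m%:R * x))
    + m%:R * x ^+ 2 * expR (m.+1%:R * x))).
  rewrite lerD // (le_trans (wnormM _ w0 _ _)) // ler_pM ?wnorm_ge0 //.
have -> : m.+1%:R * x = x + m%:R * x by rewrite -[m.+1]add1n natrD mulrDl mul1r.
rewrite [leLHS](_ : _ = (m%:R ^+ 2 + m%:R) * x ^+ 2 * expR (x + m%:R * x)); last first.
  by rewrite expRD; ring.
rewrite ler_wpM2r ?expR_ge0 //.
have -> : (x + m%:R * x) ^+ 2 = (m%:R ^+ 2 + 2 * m%:R + 1) * x ^+ 2 by ring.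
rewrite ler_wpM2r ?exprn_ge0 // -addrA lerD2l.
have := ler0n R m; lra.
Qed.

(** * Independence and expectation on a finite weighted space *)

Section FiniteIndependence.
Variables (R : realType) (V : finType) (mu : V -> R).

Definition indep (I J : eqType) (S : V -> I) (U : V -> J) :=
  forall i j, \sum_(v | (S v == i) && (U v == j)) mu v =
              (\sum_(v | S v == i) mu v) * (\sum_(v | U v == j) mu v).

(* [I] and [J] may be infinite; each fibre of [S] and [U] is represented by a
   point of [V] in order to sum over values. *)
Lemma indep_mean (A : algType R) (I J : eqType) (S : V -> I) (U : V -> J)
    (phi : I -> A) (chi : J -> A) : indep S U ->
  \sum_v mu v *: (phi (S v) * chi (U v)) =
  (\sum_v mu v *: phi (S v)) * (\sum_v mu v *: chi (U v)).
Proof.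
move=> SU.
pose rep (K : eqType) (Q : V -> K) v := odflt v [pick u | Q u == Q v].
have repE (K : eqType) (Q : V -> K) v : Q (rep K Q v) = Q v.
  by rewrite /rep; case: pickP => //= u /eqP.
have rep_eq (K : eqType) (Q : V -> K) v u : Q v = Q u -> rep K Q v = rep K Q u.
  rewrite /rep => ->; case: pickP => //= /(_ u).
  by rewrite eqxx.
have pi_sum (K : eqType) (Q : V -> K) (c : K -> A) :
    \sum_v mu v *: c (Q v) =
    \sum_x (\sum_(v | rep K Q v == x) mu v) *: c (Q x).
  rewrite (partition_big (rep K Q) xpredT) //=; apply: eq_bigr => x _.
  by rewrite scaler_suml; apply: eq_bigr => v /eqP <-; rewrite repE.
have rep_class (K : eqType) (Q : V -> K) x v : rep K Q x = x ->
    (rep K Q v == x) = (Q v == Q x).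
  move=> xx; apply/eqP/eqP => [<-|/rep_eq ->]; by rewrite ?repE.
have rep_empty (K : eqType) (Q : V -> K) x v : rep K Q x <> x -> (rep K Q v == x) = false.
  by move=> xx; apply/eqP => vx; apply: xx; rewrite -{2}vx; apply: rep_eq; rewrite -vx repE.
rewrite !pi_sum mulr_suml (partition_big (rep I S) xpredT) //=.
apply: eq_bigr => x _; rewrite mulr_sumr (partition_big (rep J U) xpredT) //=.
apply: eq_bigr => y _; rewrite -scalerAl -scalerAr scalerA.
have -> : (\sum_(v | rep I S v == x) mu v) * (\sum_(v | rep J U v == y) mu v) =
    \sum_(v | (rep I S v == x) && (rep J U v == y)) mu v.
  (* If x or y does not represent its own fibre, its class is empty and both sides vanish. *)
  have [xx|/(rep_empty I S) xx] := pselect (rep I S x = x); last first.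
    by rewrite [X in X * _]big_pred0 ?[RHS]big_pred0 ?mul0r // => v; rewrite xx.
  have [yy|/(rep_empty J U) yy] := pselect (rep J U y = y); last first.
    by rewrite [X in _ * X]big_pred0 ?[RHS]big_pred0 ?mulr0 // => v; rewrite yy ?andbF.
  rewrite (eq_bigl (fun v => S v == S x)) => [|v]; last exact: rep_class.
  rewrite [X in _ * X](eq_bigl (fun v => U v == U y)) => [|v]; last exact: rep_class.
  by rewrite -SU; apply: eq_bigl => v; rewrite !rep_class.
rewrite scaler_suml; apply: eq_bigr => v /andP[/eqP vx /eqP vy].
by rewrite -vx -vy !repE.
Qed.

End FiniteIndependence.

Definition mean (R : realType) (V : finType) (mu : V -> R) (phi : V -> R) : R :=
  \sum_v mu v * phi v.

Definition poly_mean (R : realType) (V : finType) (mu : V -> R)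
    (F : V -> {poly R}) : {poly R} :=
  \sum_v mu v *: F v.

Lemma wnorm_poly_mean (R : realType) (N : nat) (w : R) (V : finType)
    (mu : V -> R) F : 0 <= w -> (forall v, 0 <= mu v) ->
  wnorm N w (poly_mean mu F) <= mean mu (fun v => wnorm N w (F v)).
Proof.
move=> w_ge0 mu_ge0; rewrite (le_trans (wnorm_sum _ w_ge0 _ _ _)) //.
by apply: ler_sum => v _; rewrite wnormZ ger0_norm.
Qed.

Definition part_sum (V : Type) (X : nat -> V -> nat) (k : nat) (v : V) : nat :=
  (\sum_(1 <= i < k.+1) X i v)%N.

(** * The recursion for the generating functions of the partial sums *)

Section OneDependentSums.
Variables (R : realType) (N : nat) (w : R).
Hypothesis w_ge1 : 1 <= w.
Variables (V : finType) (mu : V -> R).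
Hypothesis mu_ge0 : forall v, 0 <= mu v.
Hypothesis mu_sum1 : \sum_v mu v = 1.
Variables (n : nat) (X : nat -> V -> nat) (W : R).
Hypothesis X_0 : forall v, X 0 v = 0%N.
Hypothesis w_exp_X : forall k v, (k <= n)%N -> w ^+ X k v <= W.

Local Notation wnorm := (wnorm N w).
Local Notation S := (part_sum X).

(** 1-dependence enters the recursion through these two gaps of length one. For small k the
    truncated predecessors lead to the constant S_0. *)
Hypothesis indep1 : forall k, (k < n)%N -> indep mu (S k.-1) (X k.+1).
Hypothesis indep2 : forall k, (k < n)%N ->
  indep mu (S k.-2) (fun v => (X k v, X k.+1 v)).

Local Notation mean := (mean mu).
Local Notation pgf := (poly_mean mu).
Local Notation Z k v := ('X^(X k v) - 1 : {poly R}).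
Local Notation f k := (pgf (fun v => 'X^(S k v))).
Local Notation g k := (pgf (fun v => 'X^(X k v) - 1)).
Local Notation nu k := (mean (fun v => (X k v)%:R)).
Local Notation M k := (mean (fun v => w ^+ S k v)).

Let w_ge0 : 0 <= w. Proof. exact: le_trans ler01 w_ge1. Qed.
Let W_ge1 : 1 <= W.
Proof.
have [v _|v0] := pickP (fun v : V => true).
  by have := w_exp_X v (leq0n n); rewrite X_0.
by have /eqP := mu_sum1; rewrite big_pred0 // eq_sym oner_eq0.
Qed.
Let W_ge0 : 0 <= W. Proof. exact: le_trans ler01 W_ge1. Qed.

Let mean_le phi chi : (forall v, phi v <= chi v) -> mean phi <= mean chi.
Proof. by move=> H; apply: ler_sum => v _; rewrite ler_wpM2l. Qed.

Let mean_ge0 phi : (forall v, 0 <= phi v) -> 0 <= mean phi.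
Proof. by move=> H; apply: sumr_ge0 => v _; rewrite mulr_ge0. Qed.

Let meanZ c phi : mean (fun v => c * phi v) = c * mean phi.
Proof. by rewrite /mean mulr_sumr; apply: eq_bigr => v _; rewrite mulrCA. Qed.

Let meanD phi chi : mean (fun v => phi v + chi v) = mean phi + mean chi.
Proof. by rewrite /mean -big_split; apply: eq_bigr => v _; rewrite mulrDr. Qed.

Let mean_indep (I J : eqType) (Q : V -> I) (U : V -> J) phi chi :
  indep mu Q U ->
  mean (fun v => phi (Q v) * chi (U v)) =
  mean (fun v => phi (Q v)) * mean (fun v => chi (U v)).
Proof. exact: (@indep_mean R V mu R^o). Qed.

Let SE k v : S k v = (S k.-1 v + X k v)%N.
Proof.
case: k => [|k]; first by rewrite /part_sum !big_geq // X_0.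
by rewrite /part_sum big_nat_recr.
Qed.

Let nu_ge0 k : 0 <= nu k. Proof. by apply: mean_ge0 => v; rewrite ler0n. Qed.

Let M_ge0 k : 0 <= M k.
Proof. by apply: mean_ge0 => v; rewrite exprn_ge0. Qed.

Let M_pred k : M k.-1 <= M k.
Proof.
by apply: mean_le => v; rewrite (SE k) ler_weXn2l // leq_addr.
Qed.

(** Since w^x - 1 <= W x for each value x of X_{k+1}, and w^(S_k) <= W w^(S_{k-1}), the increment is
    at most W^2 times a product whose two factors are independent. *)
Let M_S k : (k < n)%N -> M k.+1 <= M k * (1 + W ^+ 2 * nu k.+1).
Proof.
move=> kn.
have H v : w ^+ S k.+1 v <=
    w ^+ S k v + W ^+ 2 * (w ^+ S k.-1 v * (X k.+1 v)%:R).
  rewrite (SE k.+1) /= exprD -lerBlDl -{2}[w ^+ S k v]mulr1 -mulrBr.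
  have wX x : w ^+ x <= W -> w ^+ x - 1 <= W * x%:R.
    case: x => [|x] xW; first by rewrite expr0 subrr mulr0.
    apply: (@le_trans _ _ (W * 1)); last by rewrite ler_wpM2l // ler1n.
    by rewrite mulr1 (le_trans _ xW) // gerBl.
  apply: (@le_trans _ _ (w ^+ S k v * (W * (X k.+1 v)%:R))).
    by rewrite ler_wpM2l ?exprn_ge0 // wX // w_exp_X.
  rewrite (SE k) exprD.
  set Y := w ^+ S k.-1 v * (W * (X k.+1 v)%:R).
  have Y0 : 0 <= Y by rewrite !mulr_ge0 ?exprn_ge0 ?ler0n.
  rewrite [leLHS](_ : _ = w ^+ X k v * Y); last by rewrite /Y; ring.
  rewrite [leRHS](_ : _ = W * Y); last by rewrite /Y; ring.
  by rewrite ler_wpM2r // w_exp_X // ltnW.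
apply: (le_trans (mean_le H)); rewrite meanD meanZ mulrDr mulr1 lerD2l.
have -> := mean_indep (fun x => w ^+ x) (fun x => x%:R) (indep1 kn).
by rewrite mulrCA ler_wpM2r ?M_pred // mulr_ge0 ?exprn_ge0.
Qed.

Local Notation Gamma k := (\sum_(1 <= i < k.+1) nu i).

Let Gamma_ge0 k : 0 <= Gamma k.
Proof. by apply: sumr_ge0 => i _. Qed.

Let M_le k : (k <= n)%N -> M k <= expR (W ^+ 2 * Gamma k).
Proof.
elim: k => [_|k IH kn].
  rewrite big_geq // mulr0 expR0 -mu_sum1 ler_sum // => v _.
  by rewrite /part_sum big_geq // expr0 mulr1.
rewrite (le_trans (M_S kn)) // big_nat_recr //= [X in expR X]mulrDr expRD.
rewrite ler_pM ?addr_ge0 ?mulr_ge0 ?exprn_ge0 ?IH // 1?ltnW //.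
exact: expR_ge1Dx.
Qed.

(** Integrality gives linearity in X: the left side is 0 when X = 0, and otherwise at most W + 1 <=
    2 W <= 2 W X. *)
Let wnorm_Z k v : (k <= n)%N -> wnorm (Z k v) <= 2 * W * (X k v)%:R.
Proof.
move=> kn;  have := w_exp_X v kn.
case: (X k v) => [|x] xW; first by rewrite expr0 subrr wnorm0 mulr0.
rewrite (le_trans (wnormB _ w_ge0 _ _)) //.
apply: (@le_trans _ _ (2 * W * 1)); last first.
  by rewrite ler_wpM2l ?mulr_ge0 // ler1n.
have := wnorm_Xn N w_ge0 x.+1; have := wnorm1 N w_ge0; have := W_ge1; lra.
Qed.

Lemma wnorm_g k : (k <= n)%N -> wnorm (g k) <= 2 * W * nu k.
Proof.
move=> kn; rewrite (le_trans (wnorm_poly_mean _ _ w_ge0 mu_ge0)) // -meanZ.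
by apply: mean_le => v; exact: wnorm_Z.
Qed.

Let wnorm_f k : wnorm (f k) <= M k.
Proof.
by rewrite (le_trans (wnorm_poly_mean _ _ w_ge0 mu_ge0)) // mean_le // => v; exact: wnorm_Xn.
Qed.

(** Giving up the last summand of S_k at the cost of a factor W opens the gap that independence
    requires. *)
Let wnorm_XnS k F : (k <= n)%N ->
  wnorm (pgf (fun v => 'X^(S k v) * F v)) <=
  W * mean (fun v => w ^+ S k.-1 v * wnorm (F v)).
Proof.
move=> kn; rewrite (le_trans (wnorm_poly_mean _ _ w_ge0 mu_ge0)) // -meanZ.
apply: mean_le => v.
rewrite (le_trans (wnorm_XnM _ w_ge0 _ _)) // (SE k) exprD mulrA.
by rewrite ler_wpM2r ?wnorm_ge0 // mulrC ler_wpM2r ?exprn_ge0 // w_exp_X.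
Qed.

Local Notation mean_XX k := (mean (fun v => (X k v)%:R * (X k.+1 v)%:R)).

(** In the difference a - b g_{k+1}, both a and b carry z^(S_{k-1}); a factor W replaces it by the
    weight of S_{k-2}, independent of the pair (X_k, X_{k+1}). Each factor z^X - 1 costs 2 W X,
    whence W (2 W)^2 = 4 W^3. *)
Lemma wnorm_pgf_step k : (k < n)%N ->
  wnorm (f k.+1 - f k * (1 + g k.+1)) <=
  4 * W ^+ 3 * M k * (mean_XX k + nu k * nu k.+1).
Proof.
move=> kn.
pose a := pgf (fun v => 'X^(S k.-1 v) * (Z k v * Z k.+1 v)).
pose b := pgf (fun v => 'X^(S k.-1 v) * Z k v).
have fS : f k.+1 = f k + f k.-1 * g k.+1 + a.
  rewrite /poly_mean -(indep_mean (fun x => 'X^x) (fun x => 'X^x - 1) (indep1 kn)).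
  rewrite /a /poly_mean -!big_split; apply: eq_bigr => v _ /=.
  by rewrite -!scalerDr (SE k.+1) /= (SE k) !exprD; congr (_ *: _); ring.
have fk : f k = f k.-1 + b.
  rewrite /b /poly_mean -!big_split; apply: eq_bigr => v _ /=.
  by rewrite -!scalerDr (SE k) !exprD; congr (_ *: _); ring.
have -> : f k.+1 - f k * (1 + g k.+1) = a - b * g k.+1.
  by rewrite fS fk; ring.
have k1n : (k.-1 <= n)%N by rewrite (leq_trans (leq_pred _)) // ltnW.
have Mk : M k.-2 <= M k by rewrite (le_trans (M_pred _)) // M_pred.
have na : wnorm a <= W * (M k * ((2 * W) ^+ 2 * mean_XX k)).
  rewrite (le_trans (wnorm_XnS _ k1n)) // ler_wpM2l //.
  apply: (@le_trans _ _ (mean (fun v => w ^+ S k.-2 v *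
      ((2 * W) ^+ 2 * ((X k v)%:R * (X k.+1 v)%:R))))).
    apply: mean_le => v; rewrite ler_wpM2l ?exprn_ge0 //.
    rewrite (le_trans (wnormM _ w_ge0 _ _)) // expr2 mulrACA.
    by rewrite ler_pM ?wnorm_ge0 ?wnorm_Z // ltnW.
  have -> := mean_indep (fun x => w ^+ x)
    (fun x => (2 * W) ^+ 2 * (x.1%:R * x.2%:R)) (indep2 kn).
  rewrite meanZ ler_wpM2r // mulr_ge0 ?exprn_ge0 ?mulr_ge0 //.
  by apply: mean_ge0 => v; rewrite mulr_ge0 ?ler0n.
have nb : wnorm b <= W * (M k * (2 * W * nu k)).
  rewrite (le_trans (wnorm_XnS _ k1n)) // ler_wpM2l //.
  apply: (@le_trans _ _ (mean (fun v => w ^+ S k.-2 v * (2 * W * (X k v)%:R)))).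
    apply: mean_le => v; rewrite ler_wpM2l ?exprn_ge0 //.
    by rewrite wnorm_Z // ltnW.
  have -> := mean_indep (fun x => w ^+ x) (fun x => 2 * W * x.1%:R) (indep2 kn).
  rewrite meanZ ler_wpM2r ?mulr_ge0 ?nu_ge0 //.
rewrite (le_trans (wnormB _ w_ge0 _ _)) // mulrDr.
rewrite lerD //; first by rewrite (le_trans na) // le_eqVlt; apply/orP; left; apply/eqP; ring.
apply: (@le_trans _ _ ((W * (M k * (2 * W * nu k))) * (2 * W * nu k.+1))).
  by rewrite (le_trans (wnormM _ w_ge0 _ _)) // ler_pM ?wnorm_ge0 ?wnorm_g.
by rewrite le_eqVlt; apply/orP; left; apply/eqP; ring.
Qed.

(** Telescoping over k: a new step adds the recursion error and the error of replacing 1 + g_{k+1}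
    by its m-th power version, while the old error is multiplied by the new factor. *)
Lemma wnorm_pgf_sub_prod m : (0 < m)%N ->
  wnorm (f n - \prod_(1 <= k < n.+1) (1 + m%:R^-1 *: g k) ^+ m) <=
  expR ((W ^+ 2 + 2 * W) * Gamma n) *
  \sum_(1 <= k < n.+1)
    (4 * W ^+ 3 * (mean_XX k.-1 + nu k.-1 * nu k)
     + (2 * W * nu k) ^+ 2).
Proof.
(* W^2 is the growth rate of E w^(S_k), and 2 W that of the factors [h k] below. *)
move=> m0; set c := W ^+ 2 + 2 * W.
have c0 : 0 <= c by rewrite addr_ge0 ?mulr_ge0 ?exprn_ge0.
pose eps k := 4 * W ^+ 3 * (mean_XX k.-1 + nu k.-1 * nu k) + (2 * W * nu k) ^+ 2.
have XX0 k : 0 <= mean_XX k by apply: mean_ge0 => v; rewrite mulr_ge0.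
have eps0 k : 0 <= eps k.
  by rewrite addr_ge0 ?exprn_ge0 // !mulr_ge0 ?exprn_ge0 // addr_ge0 ?mulr_ge0.
pose h k := (1 + m%:R^-1 *: g k) ^+ m.
have mR0 : m%:R != 0 :> R by rewrite pnatr_eq0 -lt0n.
have gW k : (k <= n)%N -> wnorm (h k) <= expR (2 * W * nu k).
  move=> kn; rewrite (le_trans (wnormX _ w_ge0 _ _)) //.
  rewrite -[2 * W * nu k](mulVKf mR0) expRM_natl lerXn2r ?nnegrE ?wnorm_ge0 ?expR_ge0 //.
  rewrite (le_trans _ (expR_ge1Dx _)) // (le_trans (wnormD _ w_ge0 _ _)) //.
  by rewrite lerD ?wnorm1 // wnormZ ger0_norm ?invr_ge0 // ler_wpM2l ?invr_ge0 ?wnorm_g.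
have hg k : (k <= n)%N ->
    wnorm (1 + g k - h k) <= (2 * W * nu k) ^+ 2 * expR (2 * W * nu k).
  move=> kn; rewrite -wnormN opprB.
  have := wnorm_binomial_taylor N (m%:R^-1 *: g k) m w_ge0.
  rewrite wnormZ ger0_norm ?invr_ge0 // mulVKf // scalerA mulfV // scale1r.
  rewrite -/(h k) -addrA -opprD => H; rewrite (le_trans H) //.
  rewrite ler_pM ?exprn_ge0 ?wnorm_ge0 ?expR_ge0 ?ler_expR ?wnorm_g //.
  by rewrite lerXn2r ?nnegrE ?wnorm_ge0 ?mulr_ge0 ?wnorm_g.
rewrite -/(eps _).
suff H k : (k <= n)%N -> wnorm (f k - \prod_(1 <= i < k.+1) h i) <=
    expR (c * Gamma k) * \sum_(1 <= i < k.+1) eps i by exact: H.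
elim: k => [_|k IH kn].
  rewrite !big_geq // mulr0 (_ : f 0 = 1) ?subrr ?wnorm0 //.
  rewrite /poly_mean; under eq_bigr do rewrite /part_sum big_geq // expr0.
  by rewrite -scaler_suml mu_sum1 scale1r.
rewrite ![\big[_/_]_(1 <= i < k.+2) _]big_nat_recr //=.
have -> : f k.+1 - (\prod_(1 <= i < k.+1) h i) * h k.+1 =
  (f k.+1 - f k * (1 + g k.+1)) + f k * (1 + g k.+1 - h k.+1)
  + (f k - \prod_(1 <= i < k.+1) h i) * h k.+1 by ring.
have IHk := IH (ltnW kn).
have cE : 2 * W <= c by rewrite /c lerDr exprn_ge0.
have Ek : expR (W ^+ 2 * Gamma k) * expR (2 * W * nu k.+1) <=
    expR (c * (Gamma k + nu k.+1)).
  rewrite -expRD ler_expR mulrDr lerD // ler_wpM2r //.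
  by rewrite /c lerDl mulr_ge0.
have Ek1 : expR (W ^+ 2 * Gamma k) <= expR (c * (Gamma k + nu k.+1)).
  apply: le_trans Ek; rewrite ler_peMr ?expR_ge0 //.
  by rewrite -[leLHS]expR0 ler_expR !mulr_ge0.
have Mk := M_le (ltnW kn).
rewrite (le_trans (wnormD _ w_ge0 _ _)) // [leRHS]mulrDr [leLHS]addrC lerD //.
  rewrite (le_trans (wnormM _ w_ge0 _ _)) //.
  apply: (@le_trans _ _ ((expR (c * Gamma k) * \sum_(1 <= i < k.+1) eps i)
      * expR (2 * W * nu k.+1))).
    by rewrite ler_pM ?wnorm_ge0 ?gW.
  rewrite mulrAC ler_wpM2r ?sumr_ge0 // -expRD ler_expR mulrDr lerD2l.
  by rewrite ler_wpM2r.
rewrite (le_trans (wnormD _ w_ge0 _ _)) // /eps [leRHS]mulrDr lerD //.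
  rewrite (le_trans (wnorm_pgf_step kn)) //.
  rewrite [leLHS](_ : _ = M k * (4 * W ^+ 3 * (mean_XX k + nu k * nu k.+1)));
    last by ring.
  rewrite ler_pM ?(le_trans Mk) ?mulr_ge0 ?exprn_ge0 //.
  by rewrite addr_ge0 ?mulr_ge0.
rewrite (le_trans (wnormM _ w_ge0 _ _)) //.
apply: (@le_trans _ _ (expR (W ^+ 2 * Gamma k)
   * ((2 * W * nu k.+1) ^+ 2 * expR (2 * W * nu k.+1)))).
  by rewrite ler_pM ?wnorm_ge0 ?hg // (le_trans (wnorm_f _)).
by rewrite mulrCA mulrC ler_wpM2r ?exprn_ge0 ?mulr_ge0.
Qed.

End OneDependentSums.

(** * Reduction to a finite space *)

Section FiniteLaw.
Variables (R : realType) (d : measure_display) (T : measurableType d).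
Variables (P : probability T R) (V : finType) (enc : T -> V).
Hypothesis enc_meas : forall v, measurable (enc @^-1` [set v]).

Definition finite_law (v : V) : R := fine (P (enc @^-1` [set v])).

Lemma finite_law_ge0 v : 0 <= finite_law v.
Proof. by rewrite fine_ge0. Qed.

(** As [enc] takes finitely many values, the integrand is a finite combination of indicators of its
    fibres. *)
Lemma expectation_finite_law (phi : V -> R) :
  ('E_P[fun w => phi (enc w)])%E = (mean finite_law phi)%:E.
Proof.
pose I v : T -> R := phi v \o* \1_(enc @^-1` [set v]).
have L1 v : (\1_(enc @^-1` [set v]) : T -> R) \in Lfun P 1.
  by apply/Lfun1_integrable; exact: integrable_indic.
have -> : (fun w => phi (enc w)) = \sum_(f <- [seq I v | v <- enum V]) f.
  apply/funext => w; rewrite big_map big_enum fct_sumE.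
  rewrite (bigD1 (enc w)) //= /I /= indicE mem_set // mul1r big1 ?addr0 // => v vw.
  by rewrite indicE memNset ?mul0r // => /= wv; rewrite wv eqxx in vw.
rewrite expectation_sum => [|f /mapP[v _ ->]]; last exact: Lfun_scale.
rewrite big_map big_enum /mean -sumEFin; apply: eq_bigr => v _.
rewrite expectationZl // expectation_indic // /finite_law EFinM muleC.
by rewrite fineK // fin_num_measure.
Qed.

Lemma measurable_finite_law (A : pred V) : measurable [set w | A (enc w)].
Proof.
rewrite (_ : [set w | _] = \bigcup_(v in [set v | A v]) (enc @^-1` [set v])).
  by apply: fin_bigcup_measurable.
apply/seteqP; split => [w Aw|w [v /= Av wv]]; first by exists (enc w).
by rewrite /= wv.
Qed.

Lemma finite_law_event (A : pred V) :
  (\sum_(v | A v) finite_law v)%:E = P [set w | A (enc w)].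
Proof.
rewrite -expectation_indic; last exact: measurable_finite_law.
rewrite (_ : \1_ _ = fun w => (A (enc w))%:R); last first.
  apply/funext => w; rewrite indicE; congr (_%:R); congr nat_of_bool.
  by apply/idP/idP => [/set_mem|/mem_set].
rewrite (expectation_finite_law (fun v => (A v)%:R)) /mean big_mkcond /=.
by congr EFin; apply: eq_bigr => v _; case: ifP; rewrite ?mulr1 ?mulr0.
Qed.

Lemma finite_law_sum1 : \sum_v finite_law v = 1.
Proof.
apply: EFin_inj; rewrite (finite_law_event predT) -[RHS](@probability_setT _ _ _ P).
by congr (P _); apply/seteqP.
Qed.

Lemma indep_finite_law (I J : eqType) (S : V -> I) (U : V -> J) :
  (forall i j, P ([set w | S (enc w) = i] `&` [set w | U (enc w) = j]) =
    (P [set w | S (enc w) = i] * P [set w | U (enc w) = j])%E) ->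
  indep finite_law S U.
Proof.
move=> SU i j; apply: EFin_inj; rewrite EFinM !finite_law_event.
have E (K : eqType) (Q : V -> K) k :
    [set w | Q (enc w) == k] = [set w | Q (enc w) = k].
  by apply/seteqP; split => w /= /eqP.
rewrite !E -SU; congr (P _).
by apply/seteqP; split => [w /andP[/eqP ? /eqP ?]|w [/= -> ->]] //=; rewrite !eqxx.
Qed.

End FiniteLaw.

Lemma indep_cst (R : realType) (V : finType) (mu : V -> R) (I J : eqType)
    (S : V -> I) (U : V -> J) (s : I) :
  \sum_v mu v = 1 -> (forall v, S v = s) -> indep mu S U.
Proof.
move=> mu1 Ss i j; have [->|si] := eqVneq i s.
  have -> : \sum_(v | S v == s) mu v = 1.
    by rewrite -mu1; apply: eq_bigl => v; rewrite /= Ss eqxx.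
  by rewrite mul1r; apply: eq_bigl => v; rewrite Ss eqxx.
by rewrite [X in X * _]big_pred0 ?[LHS]big_pred0 ?mul0r // => v; rewrite Ss eq_sym (negbTE si).
Qed.

(** * Events determined by a block of the variables *)

Section SigmaRange.
Variables (d : measure_display) (T : measurableType d).
Variables (X : nat -> T -> nat) (p q : nat).

(** Testing fibres is enough: independence is applied to events that fix a value. *)
Definition range_measurable (K : Type) (f : T -> K) :=
  forall k, sigma_range X p q (f @^-1` [set k]).

Lemma range_measurable_X i : (p <= i <= q)%N -> range_measurable (X i).
Proof.
move=> ipq k; apply: sub_sigma_algebra; exists i => //.
by exists [set k] => //; rewrite setTI.
Qed.

Lemma range_measurable_pair (f g : T -> nat) :
  range_measurable f -> range_measurable g ->
  range_measurable (fun w => (f w, g w)).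
Proof.
move=> mf mg [a b].
rewrite (_ : _ @^-1` _ = f @^-1` [set a] `&` g @^-1` [set b]).
  (* Equipping [T] with the sigma-algebra generated by the block makes its closure properties
     available. *)
  pose C := \bigcup_(i in [set i | (p <= i <= q)%N]) g_sigma_algebra_preimage (X i).
  exact: (@measurableI _ (g_sigma_algebraType C) _ _ (mf a) (mg b)).
by apply/seteqP; split => [w /= [-> ->]|w /= [-> ->]].
Qed.

Lemma range_measurableD (f g : T -> nat) :
  range_measurable f -> range_measurable g ->
  range_measurable (fun w => f w + g w)%N.
Proof.
move=> mf mg k.
rewrite (_ : _ @^-1` _ = \bigcup_(a in [set a | (a <= k)%N])
    (fun w => (f w, g w)) @^-1` [set (a, (k - a)%N)]).
  pose C := \bigcup_(i in [set i | (p <= i <= q)%N]) g_sigma_algebra_preimage (X i).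
  apply: (@bigcup_measurable _ (g_sigma_algebraType C)) => a _.
  exact: range_measurable_pair.
apply/seteqP; split => [w /= <-|w [a /= ak [-> ->]]].
  by exists (f w) => //=; [exact: leq_addr | rewrite addKn].
by rewrite subnKC.
Qed.

End SigmaRange.

Lemma range_measurable_part_sum (d : measure_display)
    (T : measurableType d) (X : nat -> T -> nat) (q k : nat) : (k <= q)%N ->
  range_measurable X 1 q (part_sum X k).
Proof.
elim: k => [_ a|k IH kq].
  pose C := \bigcup_(i in [set i | (1 <= i <= q)%N]) g_sigma_algebra_preimage (X i).
  have [->|a0] := eqVneq a 0%N.
    rewrite (_ : _ @^-1` _ = setT); last first.
      by apply/seteqP; split => // w _; rewrite /= /part_sum big_geq.
    exact: (@measurableT _ (g_sigma_algebraType C)).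
  rewrite (_ : _ @^-1` _ = set0); last first.
    apply/seteqP; split => // w /=; rewrite /part_sum big_geq // => /eqP.
    by rewrite eq_sym (negbTE a0).
  exact: (@measurable0 _ (g_sigma_algebraType C)).
rewrite (_ : part_sum X k.+1 = fun w => (part_sum X k w + X k.+1 w)%N).
  by apply: range_measurableD; [exact: IH (ltnW kq) | exact: range_measurable_X].
by apply/funext => w; rewrite /part_sum big_nat_recr.
Qed.

(** The vector of values is a point of a finite type, exact at the indices 1 to [n] once [B] bounds
    those variables; [inord] sends an overflowing value to 0. *)
Definition digit_enc (T : Type) (n B : nat) (X : nat -> T -> nat) (w : T) :
    {ffun 'I_n.+1 -> 'I_B.+1} := [ffun i : 'I_n.+1 => inord (X i w)].

(* Setting the digit of index 0 to 0 makes S_k = S_{k-1} + X_k hold for every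
   [k], with truncated predecessors. *)
Definition digit_dec (n B k : nat) (v : {ffun 'I_n.+1 -> 'I_B.+1}) : nat :=
  if k is 0 then 0 else v (inord k).

Section Encoding.
Variables (T : Type) (n B : nat) (X : nat -> T -> nat).
Hypothesis X_le : forall k w, (1 <= k <= n)%N -> (X k w <= B)%N.

Lemma digit_encK k w : (1 <= k <= n)%N ->
  digit_dec k (digit_enc n B X w) = X k w.
Proof.
case: k => [//|k] /= kn.
by rewrite /digit_enc ffunE !inordK // ltnS X_le.
Qed.

Lemma part_sum_digit_enc k w : (k <= n)%N ->
  part_sum (@digit_dec n B) k (digit_enc n B X w) = part_sum X k w.
Proof.
move=> kn; apply: eq_big_nat => i /andP[i1 ik].
by rewrite digit_encK // i1 -ltnS (leq_trans ik).
Qed.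

End Encoding.

Lemma measurable_digit_enc (d : measure_display) (T : measurableType d)
    (X : nat -> {mfun T >-> nat}) (n B : nat) v :
  measurable (digit_enc n B (fun k => X k) @^-1` [set v]).
Proof.
rewrite (_ : _ @^-1` _ = \bigcap_(i in [set: 'I_n.+1])
    X i @^-1` [set x | inord x = v i]).
  apply: fin_bigcap_measurable => // i _.
  by rewrite -[_ @^-1` _]setTI; exact: measurable_funP.
apply/seteqP; split => [w /= <- i _|w H] /=; first by rewrite ffunE.
by apply/ffunP => i; rewrite ffunE; exact: H.
Qed.

(** * The finite approximation theorem *)

Lemma Xn_binomial (R : realType) (l r : nat) : (l < r)%N ->
  'X^l = \sum_(m < r) 'C(l, m)%:R *: ('X - 1) ^+ m :> {poly R}.
Proof.
move=> lr; rewrite -{1}['X](subrK 1) addrC exprDn.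
rewrite (big_ord_widen _ (fun i => 1 ^+ (l - i) * ('X - 1) ^+ i *+ 'C(l, i)) lr).
rewrite big_mkcond; apply: eq_bigr => m _.
rewrite expr1n mul1r -scaler_nat; case: ltnP => // lm.
by rewrite bin_small // scale0r.
Qed.

(** * Expansion of the first-order terms in powers of z - 1 *)

Section FirstOrderTerm.
Variables (R : realType) (N : nat) (w : R).
Hypothesis w_ge1 : 1 <= w.
Variables (V : finType) (mu : V -> R).
Hypothesis mu_ge0 : forall v, 0 <= mu v.
Hypothesis mu_sum1 : \sum_v mu v = 1.
Variables (W : R).
Local Notation wnorm := (wnorm N w).
Local Notation Y := ('X - 1 : {poly R}).

Let w_ge0 : 0 <= w. Proof. exact: le_trans ler01 w_ge1. Qed.

(** Averaging the pointwise Taylor bound: the binomial coefficient 'C(X, m) is the falling factorial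
    divided by m!, so its mean is a factorial moment over m!. *)
Lemma wnorm_poly_mean_taylor (X : V -> nat) s : (forall v, w ^+ X v <= W) ->
  wnorm (poly_mean mu (fun v => 'X^(X v) - 1)
    - \sum_(1 <= m < s.+1) (m`!%:R^-1 * mean mu (fun v => (X v ^_ m)%:R)) *: Y ^+ m)
  <= W * (w + 1) ^+ s.+1 / s.+1`!%:R * mean mu (fun v => (X v ^_ s.+1)%:R).
Proof.
move=> XW.
have binE x m : 'C(x, m)%:R = m`!%:R^-1 * (x ^_ m)%:R :> R.
  by rewrite -bin_ffact natrM mulrC mulfK // pnatr_eq0 -lt0n fact_gt0.
rewrite [X in wnorm X](_ : _ =
    poly_mean mu (fun v => 'X^(X v) - \sum_(m < s.+1) 'C(X v, m)%:R *: Y ^+ m)).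
  rewrite (le_trans (wnorm_poly_mean _ _ w_ge0 mu_ge0)) // mulr_sumr ler_sum // => v _.
  rewrite [leRHS]mulrCA ler_wpM2l // (le_trans (wnorm_Xn_taylor _ w_ge0 _ _ w_ge1)) //.
  rewrite binE; have := XW v; set x := w ^+ X v => xW.
  rewrite [leLHS](_ : _ = x * ((w + 1) ^+ s.+1 / s.+1`!%:R * (X v ^_ s.+1)%:R)); last by ring.
  rewrite -!mulrA ler_wpM2r // !mulr_ge0 ?exprn_ge0 ?addr_ge0 ?invr_ge0 //.
rewrite /poly_mean [RHS](_ : _ = \sum_v mu v *: ('X^(X v) - 1) -
    \sum_v mu v *: \sum_(1 <= m < s.+1) 'C(X v, m)%:R *: Y ^+ m).
  congr (_ - _).
  rewrite (eq_bigr (fun v =>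
    \sum_(1 <= m < s.+1) (mu v * 'C(X v, m)%:R) *: Y ^+ m)).
    rewrite exchange_big; apply: eq_bigr => m _ /=.
    rewrite -scaler_suml /mean mulr_sumr; congr (_ *: _); apply: eq_bigr => v _.
    by rewrite binE mulrCA.
  by move=> v _; rewrite scaler_sumr; apply: eq_bigr => m _; rewrite scalerA.
rewrite -sumrB; apply: eq_bigr => v _; rewrite -scalerBr; congr (_ *: _).
(* The term m = 0 is the constant 1, which accounts for the -1 in the integrand. *)
rewrite -(big_mkord xpredT (fun m => 'C(X v, m)%:R *: Y ^+ m)) big_nat_recl //.
by rewrite bin0 expr0 scale1r opprD addrA big_add1.
Qed.

Lemma sum_Xn_sub1 s (lambda : nat -> R) :
  \sum_(1 <= j < s.+1) lambda j *: ('X^j - 1) =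
  \sum_(1 <= m < s.+1)
    (\sum_(m <= l < s.+1) 'C(l, m)%:R * lambda l) *: Y ^+ m.
Proof.
rewrite (eq_big_nat _ _ (F2 := fun j =>
  \sum_(1 <= m < s.+1) ('C(j, m)%:R * lambda j) *: Y ^+ m)).
  rewrite exchange_big_nat; apply: eq_big_nat => m /andP[m1 ms] /=.
  (* The part l < m of the inner sum vanishes with its binomial coefficients. *)
  rewrite -scaler_suml (big_cat_nat (n := m)) //=; last exact: ltnW.
  rewrite big_nat big1 ?add0r // => l /andP[_ lm].
  by rewrite bin_small ?mul0r.
move=> j /andP[_ js].
rewrite (Xn_binomial R js) -(big_mkord xpredT (fun m => 'C(j, m)%:R *: Y ^+ m)).
rewrite big_nat_recl // bin0 expr0 scale1r addrC addKr big_add1 scaler_sumr.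
by apply: eq_bigr => m _; rewrite scalerA mulrC.
Qed.

(** Matching the coefficients of (z - 1)^m for m <= s produces the absolute values, each weighted by
    (w + 1)^m <= (w + 1)^s; the Taylor remainders of order s + 1 give the last sum. *)
Lemma wnorm_first_order_sub (n s : nat) (X : nat -> V -> nat) (lambda : nat -> R) :
  (forall k v, (1 <= k <= n)%N -> w ^+ X k v <= W) ->
  wnorm (\sum_(1 <= k < n.+1) poly_mean mu (fun v => 'X^(X k v) - 1)
         - \sum_(1 <= j < s.+1) lambda j *: ('X^j - 1)) <=
  (w + 1) ^+ s * \sum_(1 <= m < s.+1)
    `|(m`!%:R)^-1 * (\sum_(1 <= k < n.+1) mean mu (fun v => (X k v ^_ m)%:R))
       - \sum_(m <= l < s.+1) 'C(l, m)%:R * lambda l|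
  + W * (w + 1) ^+ s.+1 / s.+1`!%:R *
    \sum_(1 <= k < n.+1) mean mu (fun v => (X k v ^_ s.+1)%:R).
Proof.
move=> XW; rewrite sum_Xn_sub1.
pose A m k := m`!%:R^-1 * mean mu (fun v => (X k v ^_ m)%:R).
pose g k := poly_mean mu (fun v => 'X^(X k v) - 1).
pose b m := \sum_(m <= l < s.+1) 'C(l, m)%:R * lambda l.
have -> : \sum_(1 <= k < n.+1) g k - \sum_(1 <= m < s.+1) b m *: Y ^+ m =
  \sum_(1 <= m < s.+1) (\sum_(1 <= k < n.+1) A m k - b m) *: Y ^+ m +
  \sum_(1 <= k < n.+1) (g k - \sum_(1 <= m < s.+1) A m k *: Y ^+ m).
  rewrite [in RHS]sumrB [RHS]addrCA; congr (_ + _).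
  rewrite [X in _ = _ - X]exchange_big /= -sumrB -sumrN; apply: eq_bigr => m _ /=.
  by rewrite -scaler_suml scalerBl; ring.
rewrite (le_trans (wnormD _ w_ge0 _ _)) // lerD //.
  rewrite (le_trans (wnorm_sum _ w_ge0 _ _ _)) //.
  rewrite mulr_sumr !big_nat ler_sum // => m /andP[m1 ms].
  rewrite wnormZ -mulr_sumr mulrC ler_wpM2r //.
  rewrite (le_trans (wnorm_Xsub1_exp _ w_ge0 _)) // ler_weXn2l ?lerDr //.
rewrite (le_trans (wnorm_sum _ w_ge0 _ _ _)) // mulr_sumr !big_nat ler_sum // => k kn.
by apply: wnorm_poly_mean_taylor => v; exact: XW.
Qed.

End FirstOrderTerm.

Section FiniteApproximation.
Variables (R : realType) (N : nat) (w : R).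
Hypothesis w_ge1 : 1 <= w.
Variables (V : finType) (mu : V -> R).
Hypothesis mu_ge0 : forall v, 0 <= mu v.
Hypothesis mu_sum1 : \sum_v mu v = 1.
Variables (n : nat) (X : nat -> V -> nat) (W : R).
Hypothesis X_0 : forall v, X 0 v = 0%N.
Hypothesis w_exp_X : forall k v, (k <= n)%N -> w ^+ X k v <= W.
Hypothesis indep1 : forall k, (k < n)%N ->
  indep mu (part_sum X k.-1) (X k.+1).
Hypothesis indep2 : forall k, (k < n)%N ->
  indep mu (part_sum X k.-2) (fun v => (X k v, X k.+1 v)).
Variables (s : nat) (lambda : nat -> R).
Hypothesis lambda_ge0 : forall j, (1 <= j <= s)%N -> 0 <= lambda j.
Variable L : R.

Local Notation nu k := (mean mu (fun v => (X k v)%:R)).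

Hypothesis L_mean : (W ^+ 2 + 2 * W) * (\sum_(1 <= k < n.+1) nu k) <= L.
Hypothesis L_lambda : \sum_(1 <= j < s.+1) lambda j * (w ^+ j + 1) <= L.

(** For each m, three comparisons are chained: the generating function with A(1/m)^m, that power
    with the m-th power of the CP root, and the latter with CP itself at no cost. Only the second
    depends on m, through C / m. *)
Lemma wnorm_pgf_sub_cp_poly :
  wnorm N w (poly_mean mu (fun v => 'X^(part_sum X n v)) - cp_poly N s lambda 1) <=
  expR L * ((w + 1) ^+ s * \sum_(1 <= m < s.+1)
    `|(m`!%:R)^-1 * (\sum_(1 <= k < n.+1) mean mu (fun v => (X k v ^_ m)%:R))
       - \sum_(m <= l < s.+1) 'C(l, m)%:R * lambda l|
  + W * (w + 1) ^+ s.+1 / s.+1`!%:R *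
    (\sum_(1 <= k < n.+1) mean mu (fun v => (X k v ^_ s.+1)%:R))
  + \sum_(1 <= k < n.+1)
    (4 * W ^+ 3 * (mean mu (fun v => (X k.-1 v)%:R * (X k.-1.+1 v)%:R)
                   + nu k.-1 * nu k)
     + (2 * W * nu k) ^+ 2)).
Proof.
have w_ge0 : 0 <= w by exact: le_trans w_ge1.
have W_ge0 : 0 <= W.
  have [v _|v0] := pickP (fun v : V => true).
    exact: le_trans (exprn_ge0 _ w_ge0) (w_exp_X v (leq0n n)).
  by have /eqP := mu_sum1; rewrite big_pred0 // eq_sym oner_eq0.
have nu_ge0 k : 0 <= nu k by apply: sumr_ge0 => v _; rewrite mulr_ge0.
have Gamma_ge0 : 0 <= \sum_(1 <= k < n.+1) nu k by exact: sumr_ge0.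
have L_ge0 : 0 <= L.
  by rewrite (le_trans _ L_mean) // mulr_ge0 // addr_ge0 ?exprn_ge0 ?mulr_ge0.
set G := poly_mean _ _; set D := (X in expR L * (X + _ + _)).
set D2 := (X in expR L * (_ + X + _)); set D3 := (X in expR L * (_ + X)).
pose g k := poly_mean mu (fun v => 'X^(X k v) - 1).
pose A (t : R) := \prod_(1 <= k < n.+1) (1 + t *: g k).
have eps_le m : (0 < m)%N -> wnorm N w (G - A m%:R^-1 ^+ m) <= expR L * D3.
  move=> m0; rewrite /A -prodrXl.
  rewrite (le_trans (wnorm_pgf_sub_prod N w_ge1 mu_ge0 mu_sum1 X_0 w_exp_X
    indep1 indep2 m0)) //.
  rewrite ler_pM ?expR_ge0 ?ler_expR ?sumr_ge0 // => k _.
  rewrite addr_ge0 ?exprn_ge0 // !mulr_ge0 ?exprn_ge0 // addr_ge0 ?mulr_ge0 //.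
  by apply: sumr_ge0 => v _; rewrite !mulr_ge0.
have foA : first_order N w A (\sum_(1 <= k < n.+1) g k).
  by apply: first_order_prod => // k _; exact: first_order_affine.
have foB : first_order N w (cp_poly N s lambda)
    (\sum_(1 <= j < s.+1) lambda j *: ('X^j - 1)).
  (* Repeating the range as a filter makes the bounds on j available for [lambda_ge0]. *)
  rewrite (_ : cp_poly N s lambda = fun t =>
    \prod_(1 <= j < s.+1 | (1 <= j < s.+1)%N) poisson_poly N j (t * lambda j)).
    rewrite [X in first_order _ _ _ X]big_nat; apply: first_order_prod => // j js.
    exact/first_order_poisson_poly/lambda_ge0.
  by apply/funext => t; rewrite /cp_poly big_nat.
have nA t : 0 <= t <= 1 -> wnorm N w (A t) <= expR (t * L).
  move=> /andP[t0 t1].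
  apply: (@le_trans _ _ (expR (\sum_(1 <= k < n.+1) t * (2 * W * nu k)))).
    rewrite expR_sum (le_trans (wnorm_prod _ w_ge0 _ _ _)) // !big_nat.
    apply: ler_prod => k kn; rewrite wnorm_ge0 //=.
    rewrite (le_trans (wnormD _ w_ge0 _ _)) // (le_trans _ (expR_ge1Dx _)) //.
    rewrite lerD ?wnorm1 // wnormZ ger0_norm // ler_wpM2l //.
    by apply: (wnorm_g N w_ge1 mu_ge0 mu_sum1 X_0 w_exp_X); case/andP: kn.
  rewrite ler_expR -mulr_sumr ler_wpM2l // -mulr_sumr (le_trans _ L_mean) //.
  by rewrite ler_wpM2r // lerDr exprn_ge0.
have nB t : 0 <= t <= 1 -> wnorm N w (cp_poly N s lambda t) <= expR (t * L).
  move=> /andP[t0 t1]; rewrite (le_trans (wnorm_cp_poly N w_ge0 lambda_ge0 t0)) //.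
  by rewrite ler_expR ler_wpM2l.
have [C HC] := wnorm_first_order_pow w_ge0 foA foB nA nB L_ge0.
have GQ : wnorm N w (\sum_(1 <= k < n.+1) g k
    - \sum_(1 <= j < s.+1) lambda j *: ('X^j - 1)) <= D + D2.
  apply: wnorm_first_order_sub => // k v /andP[_]; exact: w_exp_X.
have H m : (0 < m)%N ->
    wnorm N w (G - cp_poly N s lambda 1) <= expR L * (D + D2 + D3) + C / m%:R.
  move=> m0; have cp0 := wnorm_cp_polyX N w_ge0 s lambda m0.
  set B := cp_poly N s lambda m%:R^-1 in cp0.
  rewrite (_ : G - _ = (G - A m%:R^-1 ^+ m) + ((A m%:R^-1 ^+ m - B ^+ m) +
    (B ^+ m - cp_poly N s lambda 1))); last by ring.
  rewrite (le_trans (wnormD _ w_ge0 _ _)) // [leRHS](_ : _ =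
    expR L * D3 + (expR L * (D + D2) + C / m%:R)); last by ring.
  rewrite lerD ?eps_le // (le_trans (wnormD _ w_ge0 _ _)) // cp0 addr0.
  by rewrite (le_trans (HC m m0)) // lerD2r ler_wpM2l ?expR_ge0.
apply/ler_addgt0Pr => e e0.
have [m m0 Cm] : exists2 m, (0 < m)%N & C / m%:R <= e.
  (* An Archimedean bound for |C / e|; the successor makes m positive. *)
  exists (Num.bound `|C / e|).+1 => //.
  rewrite ler_pdivrMr // mulrC -ler_pdivrMr // ltW //.
  by rewrite (le_lt_trans (ler_norm _)) // (lt_le_trans (archi_boundP _)) ?ler_nat.
by rewrite (le_trans (H m m0)) // lerD2l.
Qed.

End FiniteApproximation.

(** Here y_k is a mixed moment and c_k a covariance, so y_k + x_{k-1} x_k = c_k + 2 x_{k-1} x_k <=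
    |c_k| + x_{k-1}^2 + x_k^2. Each square occurs at most twice, which gives 8 W^3. *)
Lemma ler_sum_step_errors (R : realType) (W : R) (x y c : nat -> R) n : 0 <= W ->
  (1 <= n)%N -> x 0%N = 0 -> y 1%N = 0 ->
  (forall k, (2 <= k <= n)%N -> y k = c k + x k.-1 * x k) ->
  \sum_(1 <= k < n.+1) (4 * W ^+ 3 * (y k + x k.-1 * x k) + (2 * W * x k) ^+ 2)
  <= 4 * W ^+ 3 * (\sum_(2 <= k < n.+1) `|c k|)
     + (8 * W ^+ 3 + 4 * W ^+ 2) * \sum_(1 <= k < n.+1) x k ^+ 2.
Proof.
move=> W0 n1 x0 y1 yE.
have W30 : 0 <= 4 * W ^+ 3 by rewrite mulr_ge0 ?exprn_ge0.
(* The induction needs the stronger bound: x_n^2 has so far served only as a current term, and its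
   second copy is reserved for step n + 1. *)
suff : \sum_(1 <= k < n.+1) (4 * W ^+ 3 * (y k + x k.-1 * x k) + (2 * W * x k) ^+ 2)
  <= 4 * W ^+ 3 * (\sum_(2 <= k < n.+1) `|c k|)
     + (8 * W ^+ 3 + 4 * W ^+ 2) * \sum_(1 <= k < n.+1) x k ^+ 2
     - 4 * W ^+ 3 * x n ^+ 2.
  by move/le_trans; apply; rewrite gerBl mulr_ge0 // sqr_ge0.
elim: n n1 yE => [//|[_ _ yE|n IH _ yE]].
  rewrite !big_nat1 big_geq //= y1 x0 mul0r !add0r !mulr0 !add0r.
  have : 0 <= W ^+ 3 * x 1%N ^+ 2.
    by apply: mulr_ge0; [exact: exprn_ge0 | exact: sqr_ge0].
  by rewrite !exprMn; lra.
rewrite ![\sum_(_ <= i < n.+3) _]big_nat_recr //=.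
have /(IH isT) {}IH : forall k, (2 <= k <= n.+1)%N -> y k = c k + x k.-1 * x k.
  by move=> k /andP[k2 kn]; rewrite yE // k2 leqW.
have yn : y n.+2 + x n.+1 * x n.+2 <=
    `|c n.+2| + x n.+1 ^+ 2 + x n.+2 ^+ 2.
  rewrite yE ?leqnn //=; have := ler_norm (c n.+2).
  by have := sqr_ge0 (x n.+1 - x n.+2); nra.
have := ler_wpM2l W30 yn; rewrite exprMn; lra.
Qed.

(** The target constants leave room: 8 W^3 + 4 W^2 <= 12 W^4 <= a^4 and 4 W^3 <= a^3, while q and
    the affine factors in G are at least 1. *)
Lemma ler_constants (R : realType) (W a psi q G D s2 s3 s4 w : R) (s : nat) :
  1 <= W -> 2 * W <= a -> 0 <= psi -> 1 <= q -> 0 <= G -> 1 <= w ->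
  0 <= D -> 0 <= s2 -> 0 <= s3 -> 0 <= s4 ->
  psi * ((w + 1) ^+ s * D + W * (w + 1) ^+ s.+1 / s.+1`!%:R * s2
    + (4 * W ^+ 3 * s4 + (8 * W ^+ 3 + 4 * W ^+ 2) * s3)) <=
  psi * q * (w + 1) ^+ s * (s%:R + 1 + 4 * a ^+ 2 * G) * D
  + psi * q * (s%:R + 1 + 4 * a ^+ 2 * G) * (W * (w + 1) ^+ s.+1 / s.+1`!%:R) * s2
  + 16 * psi * a ^+ 4 * q * (5 + 6 * a ^+ 2 * G) * s3
  + 4 * psi * a ^+ 3 * q * (11 / 10 + a ^+ 2 * G) * s4.
Proof.
move=> W1 aW psi0 q1 G0 w1 D0 s20 s30 s40.
have W0 : 0 <= W by exact: le_trans W1.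
have a0 : 0 <= a by rewrite (le_trans _ aW) // mulr_ge0.
have q0 : 0 <= q by exact: le_trans q1.
have a2G : 0 <= a ^+ 2 * G by rewrite mulr_ge0 ?exprn_ge0.
have a3 : 8 * W ^+ 3 <= a ^+ 3.
  rewrite [leLHS](_ : _ = (2 * W) ^+ 3); last by ring.
  by rewrite lerXn2r // nnegrE mulr_ge0.
have a4 : 16 * W ^+ 4 <= a ^+ 4.
  rewrite [leLHS](_ : _ = (2 * W) ^+ 4); last by ring.
  by rewrite lerXn2r // nnegrE mulr_ge0.
have W34 : W ^+ 3 <= W ^+ 4 by rewrite ler_weXn2l.
have W24 : W ^+ 2 <= W ^+ 4 by rewrite ler_weXn2l.
have W40 : 0 <= W ^+ 4 by rewrite exprn_ge0.
have W30 : 0 <= W ^+ 3 by rewrite exprn_ge0.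
(* One comparison serves all four terms: u is the coefficient obtained, r the leading factor of the
   target, t its affine factor in G. *)
have K (u r t z : R) : 0 <= u -> u <= r -> 1 <= t -> 0 <= z ->
    psi * (u * z) <= psi * q * (r * t) * z.
  move=> u0 ur t1 z0; rewrite -!mulrA ler_wpM2l // !mulrA ler_wpM2r //.
  rewrite (le_trans ur) // mulrAC mulrC ler_peMr ?(le_trans u0) //.
  exact: mulr_ege1.
have T1 : 1 <= s%:R + 1 + 4 * a ^+ 2 * G.
  by rewrite -mulrA addrAC lerDr addr_ge0 ?ler0n // mulr_ge0.
have C2 : 0 <= W * (w + 1) ^+ s.+1 / s.+1`!%:R.
  by rewrite !mulr_ge0 ?invr_ge0 ?exprn_ge0 ?addr_ge0 // (le_trans ler01).
have C1 : 0 <= (w + 1) ^+ s by rewrite exprn_ge0 ?addr_ge0 // (le_trans ler01).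
set c2 := W * _ / _ in C2 *.
have H1 := K _ _ _ _ C1 (lexx _) T1 D0.
have H2 := K _ _ _ _ C2 (lexx _) T1 s20.
have H3 : psi * ((8 * W ^+ 3 + 4 * W ^+ 2) * s3) <=
    psi * q * (16 * a ^+ 4 * (5 + 6 * a ^+ 2 * G)) * s3.
  apply: K => //; last by rewrite -mulrA; lra.
    by rewrite addr_ge0 ?mulr_ge0 ?exprn_ge0.
  by lra.
have H4 : psi * (4 * W ^+ 3 * s4) <=
    psi * q * (4 * a ^+ 3 * (11 / 10 + a ^+ 2 * G)) * s4.
  by apply: K => //; lra.
rewrite [leLHS](_ : _ = psi * ((w + 1) ^+ s * D)
  + psi * (c2 * s2)
  + psi * ((8 * W ^+ 3 + 4 * W ^+ 2) * s3) + psi * (4 * W ^+ 3 * s4));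
  last by ring.
rewrite lerD ?lerD //; first by rewrite (le_trans H1) // !mulrA.
- by rewrite (le_trans H2) // le_eqVlt; apply/orP; left; apply/eqP; ring.
- by rewrite (le_trans H3) // le_eqVlt; apply/orP; left; apply/eqP; ring.
by rewrite (le_trans H4) // le_eqVlt; apply/orP; left; apply/eqP; ring.
Qed.

Lemma mean_covariance (R : realType) (V : finType) (mu phi chi : V -> R) :
  \sum_v mu v = 1 ->
  mean mu (fun v => (phi v - mean mu phi) * (chi v - mean mu chi)) =
  mean mu (fun v => phi v * chi v) - mean mu phi * mean mu chi.
Proof.
move=> mu1.
have E p q : mean mu (fun v => (phi v - p) * (chi v - q)) =
    mean mu (fun v => phi v * chi v) - p * mean mu chi - q * mean mu phi + p * q.
  rewrite -[p * q]mulr1 -mu1 /mean !mulr_sumr -!sumrB -big_split.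
  by apply: eq_bigr => v _ /=; ring.
by rewrite E; ring.
Qed.

(** * Moments, covariances and independence under the law of the digits *)

Section FiniteModel.
Variables (R : realType) (d : measure_display) (T : measurableType d).
Variables (P : probability T R) (n B : nat) (X : nat -> {RV P >-> nat}).
Hypothesis X_le : forall k w, (1 <= k <= n)%N -> (X k w <= B)%N.

Local Notation enc := (digit_enc n B (fun k => X k)).
Local Notation Y := (@digit_dec n B).
Let mu := finite_law P enc.

Let enc_meas v : measurable (enc @^-1` [set v]).
Proof. exact: measurable_digit_enc. Qed.

Lemma factorial_moment_digit j k : (1 <= k <= n)%N ->
  factorial_moment (X k) j = mean mu (fun v => (Y k v ^_ j)%:R).
Proof.
move=> kn; rewrite /factorial_moment.
rewrite (_ : (fun w => _) = fun w => (Y k (enc w) ^_ j)%:R); last first.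
  by apply/funext => w; rewrite digit_encK.
by rewrite (expectation_finite_law P enc_meas (fun v => (Y k v ^_ j)%:R)).
Qed.

Lemma covariance_digit i j : (1 <= i <= n)%N -> (1 <= j <= n)%N ->
  covariance P (fun w => (X i w)%:R) (fun w => (X j w)%:R) =
  (mean mu (fun v => (Y i v)%:R * (Y j v)%:R)
   - mean mu (fun v => (Y i v)%:R) * mean mu (fun v => (Y j v)%:R))%:E.
Proof.
move=> i1 j1.
have E k : (1 <= k <= n)%N -> (fun w => (X k w)%:R : R) = fun w => (Y k (enc w))%:R.
  by move=> kn; apply/funext => w; rewrite digit_encK.
rewrite unlock (E i i1) (E j j1).
rewrite !(expectation_finite_law P enc_meas (fun v => (Y _ v)%:R)) /=.
rewrite -mean_covariance; last exact: finite_law_sum1.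
exact: (expectation_finite_law P enc_meas (fun v =>
  ((Y i v)%:R - mean mu (fun v => (Y i v)%:R)) *
  ((Y j v)%:R - mean mu (fun v => (Y j v)%:R)))).
Qed.

Lemma probability_sum_digit k :
  P [set w | (\sum_(1 <= i < n.+1) X i w)%N = k] =
  ((poly_mean mu (fun v => 'X^(part_sum Y n v)))`_k)%:E.
Proof.
rewrite (_ : [set w | _] = [set w | part_sum Y n (enc w) == k]); last first.
  by apply/seteqP; split => w /=; rewrite part_sum_digit_enc // => /eqP.
rewrite -(finite_law_event P enc_meas (fun v => part_sum Y n v == k)).
rewrite /poly_mean coef_sum big_mkcond; congr EFin; apply: eq_bigr => v _ /=.
by rewrite coefZ coefXn eq_sym; case: eqP => _; rewrite ?mulr1 ?mulr0.
Qed.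

Hypothesis X_dep : one_dependent n X.

Let indep_part_sum0 (J : eqType) (V : _ -> J) : indep mu (part_sum Y 0) V.
Proof.
apply: (@indep_cst _ _ _ _ _ _ _ 0%N (finite_law_sum1 P enc_meas)) => v.
by rewrite /part_sum big_geq.
Qed.

Let indep_range (J : eqType) p q (U : T -> J) (V : _ -> J) :
  (p.+1 < q)%N -> (q <= n)%N ->
  range_measurable (fun k => X k) q n U ->
  (forall w, V (enc w) = U w) ->
  indep mu (part_sum Y p) V.
Proof.
(* [one_dependent] starts at p = 1; for p = 0 the partial sum is constant. *)
move=> pq qn mU VU; have [->|p0] := eqVneq p 0%N.
  exact: indep_part_sum0.
apply: indep_finite_law => // i j.
have pn : (p <= n)%N by rewrite (leq_trans _ qn) // ltnW // ltnW.
rewrite (_ : [set w | part_sum Y p (enc w) = i] =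
    part_sum (fun k => X k) p @^-1` [set i]); last first.
  by apply/seteqP; split => w /=; rewrite part_sum_digit_enc.
rewrite (_ : [set w | V (enc w) = j] = U @^-1` [set j]); last first.
  by apply/seteqP; split => w /=; rewrite VU.
apply: (X_dep (p := p) (q := q)) => //.
- by rewrite lt0n.
- exact: ltnW.
- by rewrite ltn_subRL addn1.
- exact: range_measurable_part_sum.
Qed.

Lemma indep_digit k : (k < n)%N -> indep mu (part_sum Y k.-1) (Y k.+1).
Proof.
case: k => [|k] kn /=.
  exact: indep_part_sum0.
apply: (@indep_range _ k k.+2 (X k.+2)) => //.
  by apply: range_measurable_X; rewrite leqnn.
by move=> w; rewrite digit_encK.
Qed.

Lemma indep_digit_pair k : (k < n)%N ->
  indep mu (part_sum Y k.-2) (fun v => (Y k v, Y k.+1 v)).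
Proof.
(* For k = 0 and k = 1 the truncated index is 0. *)
case: k => [|[|k]] kn; [exact: indep_part_sum0 | exact: indep_part_sum0 |].
have k2n := ltnW kn.
apply: (@indep_range _ k k.+2 (fun w => (X k.+2 w, X k.+3 w))) => //.
- apply: range_measurable_pair; apply: range_measurable_X.
    by rewrite leqnn ltnW.
  by rewrite leqnSn.
- by move=> w; rewrite !(digit_encK X_le).
Qed.

End FiniteModel.

Theorem theorem2p2 (R : realType) (d : measure_display) (T : measurableType d)
    (P : probability T R) (n : nat) (C0 : R) (X : nat -> {RV P >-> nat})
    (s : nat) (h : R) (lambda : nat -> R) :
  (1 <= n)%N -> 1 <= C0 ->
  one_dependent n X ->
  (forall i, (1 <= i <= n)%N -> forall w, (X i w)%:R <= C0) ->
  (1 <= s)%N -> 0 <= h ->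
  (forall j, (1 <= j <= s)%N -> 0 <= lambda j) ->
  let Sn := fun w => (\sum_(1 <= i < n.+1) X i w)%N in
  let F := fun k : nat => fine (P [set w | Sn w = k]) in
  let CP := fun k : nat => fine (compound_poisson s lambda [set k]) in
  let nu := fun j k : nat => factorial_moment (X k) j in
  let nu1max := \big[Num.max/0]_(1 <= j < n.+1) nu 1%N j in
  let Gamma1 := \sum_(1 <= k < n.+1) nu 1%N k in
  let cov := fun i j : nat =>
    fine (covariance P (fun w => (X i w)%:R) (fun w => (X j w)%:R)) in
  let a := expR (h * C0) * (2 + h) * Num.sqrt C0 in
  let psi := expR (Num.max (4 * a ^+ 2 * Gamma1)
    (\sum_(1 <= m < s.+1) lambda m * (expR (h * m%:R) + 1))) in
  let K1 := psi * Num.sqrt (pi + 1) * (expR h + 1) ^+ s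
    * (s%:R + 1 + 4 * a ^+ 2 * Gamma1) in
  let K2 := psi * Num.sqrt (pi + 1) * (s%:R + 1 + 4 * a ^+ 2 * Gamma1)
    * (expR (h * C0) * (expR h + 1) ^+ s.+1 / (s.+1)`!%:R) in
  let K3 := 16 * psi * a ^+ 4 * Num.sqrt (pi + 1)
    * (5 + 6 * a ^+ 2 * Gamma1) in
  let K4 := 4 * psi * a ^+ 3 * Num.sqrt (pi + 1)
    * (11 / 10 + a ^+ 2 * Gamma1) in
  a ^+ 2 * nu1max <= 1 / 100 ->
  (\sum_(0 <= k <oo) (expR (h * k%:R) * `|F k - CP k|)%:E
   <= (K1 * (\sum_(1 <= m < s.+1)
               `|(m`!%:R)^-1 * (\sum_(1 <= j < n.+1) nu m j)
                 - \sum_(m <= l < s.+1) 'C(l, m)%:R * lambda l|)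
       + K2 * (\sum_(1 <= j < n.+1) nu s.+1 j)
       + K3 * (\sum_(1 <= j < n.+1) nu 1%N j ^+ 2)
       + K4 * (\sum_(2 <= j < n.+1) `|cov j.-1 j|))%:E)%E.
Proof.
move=> n_gt0 C0_ge1 X_dep X_le s_gt0 h_ge0 lambda_ge0 Sn F CP nu nu1max Gamma1.
move=> cov a psi K1 K2 K3 K4 _.
have C0_ge0 : 0 <= C0 by exact: le_trans C0_ge1.
(* Integer values bounded by C0 are bounded by its integer part, so finitely many digits suffice. *)
pose B := Num.truncn C0.
have XB k w : (1 <= k <= n)%N -> (X k w <= B)%N.
  by move=> kn; rewrite truncn_ge_nat // X_le.
pose Y := @digit_dec n B.
pose mu := finite_law P (digit_enc n B (fun k => X k)).
have mu_ge0 v : 0 <= mu v by exact: finite_law_ge0.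
have mu_sum1 : \sum_v mu v = 1.
  by apply: finite_law_sum1 => v; exact: measurable_digit_enc.
pose w := expR h; pose W := expR (h * C0).
have w_ge1 : 1 <= w by rewrite -[leLHS]expR0 ler_expR.
have W_ge1 : 1 <= W by rewrite -[leLHS]expR0 ler_expR mulr_ge0.
(* This holds for every digit vector, attained or not, because every digit is at most [B]. *)
have w_exp_Y k v : (k <= n)%N -> w ^+ Y k v <= W.
  move=> _; rewrite -expRM_natr ler_expR ler_wpM2l //.
  rewrite -(truncn_ge_nat _ C0_ge0); case: k => [//|k] /=.
  by rewrite -ltnS.
have nuE j k : (1 <= k <= n)%N -> nu j k = mean mu (fun v => (Y k v ^_ j)%:R).
  exact: factorial_moment_digit.
have nu1E k : (1 <= k <= n)%N -> nu 1%N k = mean mu (fun v => (Y k v)%:R).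
  by move=> kn; rewrite nuE //; apply: eq_bigr => v _; rewrite ffactn1.
pose x k := mean mu (fun v => (Y k v)%:R).
pose y k := mean mu (fun v => (Y k.-1 v)%:R * (Y k.-1.+1 v)%:R).
have x_ge0 k : 0 <= x k by apply: sumr_ge0 => v _; rewrite mulr_ge0.
have Gamma1E : Gamma1 = \sum_(1 <= k < n.+1) x k.
  by apply: eq_big_nat => k kn; rewrite nu1E.
have Gamma1_ge0 : 0 <= Gamma1 by rewrite Gamma1E sumr_ge0.
(* a = W (2 + h) sqrt(C0), with h >= 0 and C0 >= 1. *)
have aW : 2 * W <= a.
  rewrite /a -mulrA mulrC ler_wpM2l ?expR_ge0 // -[leLHS]mulr1.
  by rewrite ler_pM ?lerDl // -[leLHS]sqrtr1 ler_sqrt.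
have a2W : 4 * W ^+ 2 <= a ^+ 2.
  rewrite [leLHS](_ : _ = (2 * W) ^+ 2); last by ring.
  by rewrite lerXn2r // nnegrE ?(le_trans _ aW) // mulr_ge0 // (le_trans _ W_ge1).
pose L := Num.max (4 * a ^+ 2 * Gamma1)
  (\sum_(1 <= m < s.+1) lambda m * (w ^+ m + 1)).
have psiE : psi = expR L.
  rewrite /psi /L; congr (expR (Num.max _ _)).
  by apply: eq_bigr => m _; rewrite expRM_natr.
(* As W >= 1, W^2 + 2 W <= 3 W^2, below 4 a^2 since 4 W^2 <= a^2. *)
have L_mean : (W ^+ 2 + 2 * W) * (\sum_(1 <= k < n.+1) x k) <= L.
  rewrite /L le_max; apply/orP; left; rewrite -Gamma1E ler_wpM2r //.
  by nra.
have L_lambda : \sum_(1 <= j < s.+1) lambda j * (w ^+ j + 1) <= L.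
  by rewrite /L le_max lexx orbT.
pose D := \sum_(1 <= m < s.+1)
    `|m`!%:R^-1 * (\sum_(1 <= j < n.+1) nu m j)
       - \sum_(m <= l < s.+1) 'C(l, m)%:R * lambda l|.
set rhs := (X in (_ <= X%:E)%E).
(* The terms are nonnegative, so it is enough to bound the partial sums uniformly in [N]; each is a
   truncated norm. *)
suff bound N : \sum_(0 <= k < N) expR (h * k%:R) * `|F k - CP k| <= rhs.
  apply: lime_le.
    by apply: is_cvg_nneseries => k _ _; rewrite lee_fin mulr_ge0 ?expR_ge0.
  by apply: nearW => N; rewrite sumEFin lee_fin.
have CPE k : (k < N)%N -> CP k = (cp_poly N s lambda 1)`_k.
  by move=> kN; rewrite /CP (compound_poissonE lambda_ge0 kN).
have FE k : F k = (poly_mean mu (fun v => 'X^(part_sum Y n v)))`_k.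
  by rewrite /F /Sn (probability_sum_digit XB).
have -> : \sum_(0 <= k < N) expR (h * k%:R) * `|F k - CP k| =
  wnorm N w (poly_mean mu (fun v => 'X^(part_sum Y n v)) - cp_poly N s lambda 1).
  rewrite big_mkord; apply: eq_bigr => k _.
  by rewrite coefB expRM_natr -FE -CPE.
have H := wnorm_pgf_sub_cp_poly N w_ge1 mu_ge0 mu_sum1
  (fun v => erefl) w_exp_Y (indep_digit XB X_dep) (indep_digit_pair XB X_dep)
  lambda_ge0 L_mean L_lambda.
rewrite (le_trans H) // {H} -psiE -/(x _).
have q_ge1 : 1 <= Num.sqrt (pi + 1) :> R.
  by rewrite -[leLHS]sqrtr1 ler_sqrt; have := pi_ge2 R; lra.
have nu_ge0 j k : (1 <= k <= n)%N -> 0 <= nu j k.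
  by move=> kn; rewrite nuE //; apply: sumr_ge0 => v _; rewrite mulr_ge0.
have S2_ge0 : 0 <= \sum_(1 <= j < n.+1) nu s.+1 j.
  by rewrite big_nat sumr_ge0 // => j jn; exact: nu_ge0.
have S3_ge0 : 0 <= \sum_(1 <= j < n.+1) nu 1%N j ^+ 2.
  by rewrite sumr_ge0 // => j _; exact: sqr_ge0.
have S4_ge0 : 0 <= \sum_(2 <= j < n.+1) `|cov j.-1 j| by rewrite sumr_ge0.
have D_ge0 : 0 <= D by rewrite sumr_ge0.
apply: le_trans (ler_constants s W_ge1 aW (expR_ge0 _) q_ge1 Gamma1_ge0 w_ge1
  D_ge0 S2_ge0 S3_ge0 S4_ge0).
have nu_sum j : \sum_(1 <= k < n.+1) nu j k =
    \sum_(1 <= k < n.+1) mean mu (fun v => (Y k v ^_ j)%:R).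
  by apply: eq_big_nat => k kn; exact: nuE.
rewrite ler_wpM2l ?expR_ge0 // lerD //.
  rewrite nu_sum /D; under [in leRHS]eq_bigr do rewrite nu_sum.
  exact: lexx.
have -> : \sum_(1 <= j < n.+1) nu 1%N j ^+ 2 = \sum_(1 <= j < n.+1) x j ^+ 2.
  by apply: eq_big_nat => k kn; rewrite nu1E.
(* At the left end the padding X_0 = 0 kills x_0 and y_1; from k = 2 on, y_k is the covariance plus
   the product of means. *)
apply: (@ler_sum_step_errors _ W x y (fun j => cov j.-1 j)) => //.
- exact: le_trans W_ge1.
- by rewrite /x /mean big1 // => v _; rewrite mulr0.
- by rewrite /y /mean big1 // => v _; rewrite mul0r mulr0.
move=> [|[|k]] // /andP[_ kn].
by rewrite /cov (covariance_digit XB) //= ?subrK // ltnW.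
Qed.
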